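(* Let $G$ be a compactly generated locally compact group and $\mathcal F$ a class of representations of $G$ such that $\sup_{(\pi,E)\in\mathcal F}\|\pi(g)\|_{B(E)}$ is bounded on compact subsets of $G$. If $\mathcal F$ is weakly self-adjoint, then a Kazhdan projection in $\mathcal C_{\mathcal F}(G)$ is automatically central and self-adjoint. If moreover the map $f\mapsto\overline f$ on $C_c(G)$ extends to a continuous map on $\mathcal C_{\mathcal F}(G)$, then a Kazhdan projection in $\mathcal C_{\mathcal F}(G)$ is automatically central, self-adjoint and real.
   Context: Standing assumptions: $G$ is compactly generated, locally compact, separable and infinite; $\int f$ is integration against a left Haar measure $dg$. A representation $(\pi,E)$ is a strongly continuous homomorphism from $G$ to the bounded invertible operators of a Banach space $E$; $\pi(f)=\int f(g)\pi(g)\,dg$ for $f\in C_c(G)$. The dual representation $({}^t\pi,{}^tE)$: ${}^tE\subset E^*$ is the closed subspace of those $\xi$ for which $g\mapsto\pi(g^{-1})^*\xi$ is continuous, and ${}^t\pi(g)$ is the restriction of $\pi(g^{-1})^*$ to ${}^tE$. $\mathcal F^*$ is the class of dual representations of members of $\mathcal F$. $\mathcal C_{\mathcal F}(G)$ is the (Hausdorff) completion of $C_c(G)$ for $\|f\|_{\mathcal F}=\sup_{(\pi,E)\in\mathcal F}\|\pi(f)\|_{B(E)}$, a Banach algebra for convolution. A Kazhdan projection in it is an idempotent $p$ in the closure of $\{f\in C_c(G):\int f=1\}$ such that $\pi(p)$ is a projection onto $E^\pi=\{x:\pi(g)x=x\ \forall g\}$ for every $(\pi,E)\in\mathcal F$;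 it is central if it lies in the center of $\mathcal C_{\mathcal F}(G)$. $\mathcal F$ is weakly self-adjoint if the norms $\|\cdot\|_{\mathcal F}$ and $\|\cdot\|_{\mathcal F^*}$ are equivalent on $C_c(G)$. Equivalently, the map $f\mapsto\widetilde f$ extends to a bounded map of $\mathcal C_{\mathcal F}(G)$, where $\widetilde f\,dg$ is the image of the measure $f\,dg$ under $g\mapsto g^{-1}$. Then $a\in\mathcal C_{\mathcal F}(G)$ is self-adjoint if $\widetilde a=a$. When complex conjugation $f\mapsto\overline f$ extends to $\mathcal C_{\mathcal F}(G)$, $a$ is real if $\overline a=a$. *)

(* Defs.v *)
From HB Require Import structures.
From mathcomp Require Import all_boot all_order all_algebra complex ring.
From mathcomp Require Import all_classical all_reals all_analysis.

Set Implicit Arguments.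
Unset Strict Implicit.
Unset Printing Implicit Defensive.

Import Order.TTheory GRing.Theory Num.Theory.
Import numFieldNormedType.Exports.

Local Open Scope classical_set_scope.
Local Open Scope ring_scope.
Local Open Scope complex_scope.

(* All Banach spaces are complex; the scalars are R[i] with R : realType. The
   norm of a normedModType R[i] takes its values in R[i]; rnorm is the same norm
   with values in R. *)
Definition rnorm (R : realType) (V : normedModType R[i]) (x : V) : R :=
  complex.Re `|x|.

Section rnorm.
Context {R : realType} {V : normedModType R[i]}.
Implicit Types x y : V.

Lemma rnormE x : `|x| = (rnorm x)%:C.
Proof.
rewrite /rnorm; have := normr_ge0 x; set z := Num.norm x.
by move: z => [a b]; rewrite lecE /= => /andP[/eqP -> _].
Qed.

Lemma rnorm_ge0 x : 0 <= rnorm x.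
Proof. by have := normr_ge0 x; rewrite rnormE -(rmorph0 (real_complex R)) lecR. Qed.

Lemma rnormD x y : rnorm (x + y) <= rnorm x + rnorm y.
Proof. by rewrite -lecR rmorphD /= -!rnormE ler_normD. Qed.

Lemma rnormZ (c : R[i]) x : rnorm (c *: x) = complex.Re `|c| * rnorm x.
Proof.
rewrite {1}/rnorm normrZ (rnormE x).
by move: (Num.norm c) => [a b] /=; rewrite mulr0 subr0. Qed.

Lemma rnorm0_eq0 x : rnorm x = 0 -> x = 0.
Proof. by move=> x0; apply/normr0_eq0; rewrite rnormE x0. Qed.

Lemma rnorm0 : rnorm (0 : V) = 0.
Proof. by rewrite /rnorm normr0. Qed.

Lemma rnormN x : rnorm (- x) = rnorm x.
Proof. by rewrite /rnorm normrN. Qed.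

Lemma rnormB x y : rnorm (x - y) = rnorm (y - x).
Proof. by rewrite /rnorm distrC. Qed.

Lemma rnorm_dist x y : `|rnorm x - rnorm y| <= rnorm (x - y).
Proof.
have H (a b : V) : rnorm a - rnorm b <= rnorm (a - b).
  by rewrite lerBlDr -{1}(subrK b a) rnormD.
by rewrite ler_norml H andbT lerNl opprB rnormB H.
Qed.

End rnorm.

Section complexC.
Context {R : realType}.

Lemma cauchy_rnorm (V : normedModType R[i]) (F : set_system V) {FF : ProperFilter F} :
  cauchy F <-> forall e : R, 0 < e -> exists x, \forall y \near F, rnorm (x - y) < e.
Proof.
split=> [/cauchyP + e e0|H].
  have e0' : 0 < e%:C by rewrite ltcR.
  move=> /(_ _ e0')[x Fx]; exists x; apply: filterS Fx => y.
  by rewrite -ball_normE /= rnormE ltcR.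
apply: cauchy_exP => e; rewrite ltcE /= => /andP[/eqP ie re].
have [x Hx] := H _ re; exists x; apply: filterS Hx => y.
rewrite -ball_normE /= rnormE => xy.
by rewrite ltcE /= ie eqxx.
Qed.

Lemma cvg_rnorm (V : normedModType R[i]) (T : Type) (F : set_system T) {FF : Filter F} (f : T -> V) (l : V) :
  f @ F --> l <-> forall e : R, 0 < e -> \forall y \near F, rnorm (l - f y) < e.
Proof.
split=> [/cvgrPdist_lt H e e0|H].
  have e0' : 0 < e%:C by rewrite ltcR.
  by apply: filterS (H _ e0') => y; rewrite rnormE ltcR.
apply/cvgrPdist_lt => e; rewrite ltcE /= => /andP[/eqP ie re].
apply: filterS (H _ re) => y xy.
by rewrite rnormE ltcE /= ie eqxx.
Qed.

Lemma Re_le_rnorm (z : R[i]^o) : `|complex.Re z| <= rnorm z.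
Proof.
case: z => a b; rewrite /rnorm /= -sqrtr_sqr ler_wsqrtr// lerDl sqr_ge0 //.
Qed.
Lemma Im_le_rnorm (z : R[i]^o) : `|complex.Im z| <= rnorm z.
Proof.
case: z => a b; rewrite /rnorm /= -sqrtr_sqr ler_wsqrtr// lerDr sqr_ge0 //.
Qed.
Lemma rnorm_le_ReIm (z : R[i]^o) : rnorm z <= `|complex.Re z| + `|complex.Im z|.
Proof.
case: z => a b; rewrite /rnorm /= -[leRHS]ger0_norm ?addr_ge0// -sqrtr_sqr ler_wsqrtr//.
by rewrite sqrrD !real_normK ?num_real// -addrA lerD2l lerDr mulrn_wge0// mulr_ge0.
Qed.

Lemma complex_complete (F : set_system R[i]^o) : ProperFilter F -> cauchy F -> cvg F.
Proof.
move=> FF /cauchy_rnorm cF.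
have reC (h : R[i]^o -> R) : (forall z, `|h z| <= rnorm z) -> {morph h : x y / x - y} ->
    exists l : R, h @ F --> l.
  move=> hb hB.
  apply/cvg_ex; apply: cauchy_cvg.
  apply: (@cauchy_exP R R) => e e0; have [x Hx] := cF _ e0.
  exists (h x); rewrite /fmapE /=.
  apply: filterS Hx => y xy; rewrite -ball_normE /= -hB.
  exact: le_lt_trans (hb _) xy.
have [a Ha] := reC _ Re_le_rnorm (fun x y => let: a +i* b := x in let: c +i* d := y in erefl).
have [b Hb] := reC _ Im_le_rnorm (fun x y => let: a +i* b := x in let: c +i* d := y in erefl).
apply/cvg_ex; exists (a +i* b : R[i]^o); apply/(cvg_rnorm id) => e e0.
have e2 : 0 < e / 2 by rewrite divr_gt0.
move/cvgrPdist_lt : Ha => /(_ _ e2) Ha; move/cvgrPdist_lt : Hb => /(_ _ e2) Hb.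
apply: filterS2 Ha Hb => -[c d] /= ac bd.
apply: le_lt_trans (rnorm_le_ReIm _) _ => /=.
by rewrite [e]splitr ltrD.
Qed.
End complexC.

(* Restriction of scalars from R[i] to R; it gives access to Banach_Steinhauss,
   which is stated over realType. *)
Definition realify (R : realType) (V : normedModType R[i]) : Type := V.

Section realify.
Context {R : realType} (V : normedModType R[i]).
Local Notation VR := (realify V).
HB.instance Definition _ := GRing.Zmodule.copy VR V.
Let sc (r : R) (x : VR) : VR := r%:C *: (x : V).
Let scA a b v : sc a (sc b v) = sc (a * b) v.
Proof. by rewrite /sc scalerA -rmorphM. Qed.
Let sc1 : left_id 1 sc.
Proof. by move=> x; rewrite /sc rmorph1 scale1r. Qed.
Let scDr : right_distributive sc +%R.
Proof. by move=> a x y; exact: scalerDr. Qed.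
Let scDl v : {morph sc^~ v : a b / a + b}.
Proof. by move=> a b; rewrite /sc rmorphD; exact: scalerDl. Qed.
HB.instance Definition _ := GRing.Zmodule_isLmodule.Build R VR scA sc1 scDr scDl.
Let nD (x y : VR) : rnorm (x + y : V) <= rnorm (x : V) + rnorm (y : V).
Proof. exact: rnormD. Qed.
Let nZ (r : R) (x : VR) : rnorm (r *: x : VR) = `|r| * rnorm (x : V).
Proof. by rewrite rnormZ normc_def /= expr0n addr0 sqrtr_sqr. Qed.
Let n0 (x : VR) : rnorm (x : V) = 0 -> x = 0.
Proof. exact: rnorm0_eq0. Qed.
HB.instance Definition _ := Lmodule_isNormed.Build R VR nD nZ n0.
End realify.

Section realify_complete.
Context {R : realType} (V : completeNormedModType R[i]).
Local Notation VR := (realify V).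
Lemma realify_complete (F : set_system VR) : ProperFilter F -> cauchy F -> cvg F.
Proof.
move=> FF /cauchyP cF.
have : cauchy (F : set_system V).
  apply/cauchy_rnorm => e /cF[x Fx]; exists x; apply: filterS Fx => y.
  by rewrite -ball_normE.
move=> /cauchy_cvg /cvg_ex[l Fl]; apply/cvg_ex; exists l.
apply/(@cvgrPdist_lt _ _ _ F _ id) => e e0.
have H := (cvg_rnorm id l).1 Fl e e0. exact: H.
Qed.
HB.instance Definition _ := Uniform_isComplete.Build VR realify_complete.
End realify_complete.

Definition bounded_linear (R : realType) (V W : normedModType R[i])
    (T : V -> W) : Prop := linear T /\ continuous T.

Definition op_norm (R : realType) (V W : normedModType R[i]) (T : V -> W) : R :=
  sup [set rnorm (T x) | x in [set x | rnorm x <= 1]].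

Section bounded_linear.
Context {R : realType} {V W : normedModType R[i]}.
Implicit Type T : V -> W.

Let pack (T : V -> W) (lT : linear T) : {linear V -> W} :=
  HB.pack T (GRing.isLinear.Build _ _ _ _ _ lT).

Lemma lin0 T : linear T -> T 0 = 0.
Proof. by move=> lT; exact: (linear0 (pack lT)). Qed.
Lemma linB T : linear T -> {morph T : x y / x - y}.
Proof. by move=> lT; exact: (linearB (pack lT)). Qed.
Lemma linD T : linear T -> {morph T : x y / x + y}.
Proof. by move=> lT; exact: (linearD (pack lT)). Qed.
Lemma linZ T : linear T -> forall a, {morph T : x / a *: x}.
Proof. by move=> lT; move=> a x; exact: (linearZZ (pack lT)). Qed.

Lemma bounded_linear_bound T : bounded_linear T ->
  exists2 M, 0 <= M & forall x, rnorm (T x) <= M * rnorm x.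
Proof.
move=> [lT cT].
have /linear_boundedP/pinfty_ex_gt0[M] : bounded_near (pack lT) (nbhs 0).
  by apply: continuous_linear_bounded; exact: cT.
rewrite ltcE /= => /andP[/eqP iM M0] H.
exists (complex.Re M); first exact: ltW.
move=> x; have := H x; rewrite !rnormE.
by case: M iM {H M0} => a b /= ->; rewrite -(rmorphM (real_complex R)) /= lecR.
Qed.

Lemma bound_bounded_linear T M : linear T ->
  (forall x, rnorm (T x) <= M * rnorm x) -> bounded_linear T.
Proof.
move=> lT bT; split => // x.
apply: (cvg_rnorm T (T x)).2 => e e0.
have M0 : 0 < `|M| + 1 by rewrite ltr_wpDl.
have d0 : 0 < e / (`|M| + 1) by rewrite divr_gt0.
have := (@cvg_rnorm R V V (nbhs x) (nbhs_filter x) id x).1 (fun=> id) _ d0.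
apply: filterS => y xy; rewrite -linB//.
apply: le_lt_trans (bT _) _.
rewrite (@le_lt_trans _ _ ((`|M| + 1) * rnorm (x - y)))//.
  by rewrite ler_wpM2r ?rnorm_ge0// ler_wpDr// ler_norm.
by rewrite mulrC -ltr_pdivlMr.
Qed.

Lemma op_norm_le T M : linear T -> 0 <= M ->
  (forall x, rnorm (T x) <= M * rnorm x) -> op_norm T <= M.
Proof.
move=> lT M0 bT; apply: ge_sup.
  by exists (rnorm (T 0)), 0 => //=; rewrite rnorm0.
move=> _ [x /= x1 <-]; apply: le_trans (bT x) _.
by rewrite -[leRHS]mulr1 ler_wpM2l.
Qed.

Lemma op_normP T : bounded_linear T ->
  forall x, rnorm (T x) <= op_norm T * rnorm x.
Proof.
move=> bT x; have [M M0 HM] := bounded_linear_bound bT.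
have lT := bT.1.
have [x0|x0] := eqVneq (rnorm x) 0.
  by rewrite (rnorm0_eq0 x0) lin0// !rnorm0 mulr0.
have x0' : 0 < rnorm x by rewrite lt_neqAle eq_sym x0 rnorm_ge0.
rewrite -ler_pdivrMr//.
have cE : complex.Re `|((rnorm x)^-1)%:C| = (rnorm x)^-1.
  by rewrite normc_def /= expr0n addr0 sqrtr_sqr ger0_norm// invr_ge0 ltW.
have -> : rnorm (T x) / rnorm x = rnorm (T (((rnorm x)^-1)%:C *: x)).
  by rewrite linZ// rnormZ cE mulrC.
apply: ub_le_sup; last first.
  by exists (((rnorm x)^-1)%:C *: x) => //=; rewrite rnormZ cE mulVf.
exists M => _ [y /= y1 <-]; apply: le_trans (HM y) _.
by rewrite -[leRHS]mulr1 ler_wpM2l.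
Qed.

Lemma op_norm_ge0 T : bounded_linear T -> 0 <= op_norm T.
Proof.
move=> bT; have [M M0 HM] := bounded_linear_bound bT.
apply: (@le_trans _ _ (rnorm (T 0))); first exact: rnorm_ge0.
apply: ub_le_sup; last by exists 0 => //=; rewrite rnorm0.
exists M => _ [y /= y1 <-]; apply: le_trans (HM y) _.
by rewrite -[leRHS]mulr1 ler_wpM2l.
Qed.

Lemma bounded_linear0 : bounded_linear (0 : V -> W).
Proof.
apply: (@bound_bounded_linear _ 0); first by move=> a x y /=; rewrite scaler0 addr0.
by move=> x; rewrite mul0r [leLHS]rnorm0.
Qed.

Lemma bounded_linearP (a : R[i]) S T : bounded_linear S -> bounded_linear T ->
  bounded_linear (a *: S + T).
Proof.
move=> [lS cS] [lT cT]; split=> [b x y|x].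
  rewrite /= !fctE lS lT.
  by rewrite !scalerDr !scalerA (mulrC b a) addrACA.
apply: cvgD; last exact: cT.
by apply: cvgZr; exact: cS.
Qed.

End bounded_linear.

Lemma comp_bounded_linear (R : realType) (U V W : normedModType R[i])
  (S : U -> V) (T : V -> W) : bounded_linear S -> bounded_linear T ->
  bounded_linear (T \o S).
Proof.
move=> [lS cS] [lT cT]; split=> [a x y|x] /=; first by rewrite lS lT.
by apply: continuous_comp; [exact: cS|exact: cT].
Qed.

Lemma uniform_boundedness (R : realType) (V : completeNormedModType R[i])
    (W : normedModType R[i]) (F : set (V -> W)) :
  (forall T, F T -> bounded_linear T) ->
  (forall x, exists M, forall T, F T -> rnorm (T x) <= M) ->
  exists2 M, 0 <= M & forall T, F T -> forall x, rnorm (T x) <= M * rnorm x.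
Proof.
move=> bF pF.
pose F' : set (realify V -> realify W) := F.
have UB : uniform_bounded F'.
  apply: (@Banach_Steinhauss R (realify V) (realify W)); last first.
    by move=> x; have [M HM] := pF x; exists M.
  move=> T FT; have [M M0 HM] := bounded_linear_bound (bF _ FT).
  split=> [r|a x y].
    exists (M * r) => x xr; apply: le_trans (HM x) _.
    by rewrite ler_wpM2l.
  exact: (bF _ FT).1.
have [M HM] := UB 1.
exists `|M| => // T FT x; have bT := bF _ FT.
apply: le_trans (op_normP bT x) _.
rewrite ler_wpM2r ?rnorm_ge0//; apply: ge_sup.
  by exists (rnorm (T 0)), 0 => //=; rewrite rnorm0.
move=> _ [y /= y1 <-]; apply: le_trans (ler_norm M).
exact: HM.
Qed.

(* dual E is the space of continuous linear functionals on E, normed by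
   op_norm. *)
Definition functionals (R : realType) (E : normedModType R[i]) :
  {pred E -> R[i]^o} := mem [set xi | bounded_linear xi].
Arguments functionals {R} E.

Lemma functionals_submod_closed (R : realType) (E : normedModType R[i]) :
  submod_closed (functionals E).
Proof.
split; first by rewrite inE; exact: bounded_linear0.
move=> a S T /set_mem bS /set_mem bT; apply: mem_set.
exact: (bounded_linearP a bS bT).
Qed.

HB.instance Definition _ (R : realType) (E : normedModType R[i]) :=
  GRing.isSubmodClosed.Build _ _ (functionals E) (@functionals_submod_closed R E).

Record dual (R : realType) (E : normedModType R[i]) := Dual {
  dual_fun :> E -> R[i]^o;
  dual_funP : dual_fun \in functionals E }.

Section dual.
Context {R : realType} {E : normedModType R[i]}.
Local Notation E' := (dual E).
HB.instance Definition _ := [isSub of E' for @dual_fun R E].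
HB.instance Definition _ := [Choice of E' by <:].
HB.instance Definition _ := [SubChoice_isSubLmodule of E' by <:].

Lemma dual_bl (xi : E') : bounded_linear xi.
Proof. by have := dual_funP xi; rewrite inE. Qed.

Let nm (xi : E') : R[i] := (op_norm xi)%:C.
Let nmD (x y : E') : nm (x + y) <= nm x + nm y.
Proof.
rewrite /nm -rmorphD /= lecR; apply: op_norm_le; first exact: (dual_bl (x + y)).1.
  by rewrite addr_ge0 ?op_norm_ge0//; exact: dual_bl.
move=> v; rewrite mulrDl; apply: le_trans (rnormD _ _) _.
by apply: lerD; apply: op_normP; exact: dual_bl.
Qed.
Let nmZ (a : R[i]) (x : E') : nm (a *: x) = `|a| * nm x.
Proof.
have le b (y : E') : nm (b *: y) <= `|b| * nm y.
  rewrite /nm (rnormE (b : R[i]^o)) -rmorphM /= lecR.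
  apply: op_norm_le; first exact: (dual_bl (b *: y)).1.
    by rewrite mulr_ge0 ?rnorm_ge0// op_norm_ge0//; exact: dual_bl.
  move=> v; rewrite -mulrA [leLHS]rnormZ.
  by apply: ler_wpM2l (op_normP (dual_bl y) v); exact: (@rnorm_ge0 _ R[i]^o b).
apply/eqP; rewrite eq_le le /=.
have [->|a0] := eqVneq a 0.
  rewrite normr0 mul0r /nm -(rmorph0 (real_complex R)) lecR op_norm_ge0//; exact: dual_bl.
have := le a^-1 (a *: x); rewrite scalerA mulVf// scale1r => H.
by rewrite mulrC -ler_pdivlMr ?normr_gt0// mulrC -normfV.
Qed.
Let nm0 (x : E') : nm x = 0 -> x = 0.
Proof.
rewrite /nm => /complexI x0; apply/val_inj/funext => v /=.
apply: rnorm0_eq0; apply/eqP; rewrite eq_le rnorm_ge0 andbT.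
by have := op_normP (dual_bl x) v; rewrite x0 mul0r.
Qed.
HB.instance Definition _ := Lmodule_isNormed.Build R[i] E' nmD nmZ nm0.

Lemma dual_rnorm (x : E') : rnorm x = op_norm x.
Proof. by []. Qed.

Lemma dual_complete (F : set_system E') : ProperFilter F -> cauchy F -> cvg F.
Proof.
move=> FF /cauchy_rnorm cF.
have ev v : exists l : R[i]^o, (fun x : E' => (x v : R[i]^o)) @ F --> l.
  apply/cvg_ex; apply: complex_complete; apply/cauchy_rnorm => e e0.
  have d0 : 0 < e / (rnorm v + 1) by rewrite divr_gt0// ltr_wpDl// rnorm_ge0.
  have [x Fx] := cF _ d0; exists (x v); rewrite /fmapE /=.
  apply: filterS Fx => y xy; have := op_normP (dual_bl (x - y)) v.
  rewrite -dual_rnorm => /le_lt_trans; apply.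
  apply: (@le_lt_trans _ _ (rnorm (x - y) * (rnorm v + 1))).
    by rewrite ler_wpM2l ?rnorm_ge0// lerDl.
  by rewrite -ltr_pdivlMr// ltr_wpDl// rnorm_ge0.
have [l Hl] := choice ev.
have key (e : R) x : 0 < e -> (\forall y \near F, rnorm (x - y) < e) ->
    forall v, rnorm (x v - l v : R[i]^o) <= e * rnorm v.
  move=> e0 Fx v; apply/ler_addgt0Pr => d d0.
  have [y [xy yl]] : exists y : E', rnorm (x - y) < e /\ rnorm (l v - y v : R[i]^o) < d.
    by apply: (@filter_ex _ F); apply: filterI Fx ((cvg_rnorm _ _).1 (Hl v) _ d0).
  rewrite -[_ - _](subrKA (y v)); apply: le_trans (rnormD _ _) _.
  rewrite lerD//; last by rewrite rnormB ltW.
  apply: le_trans (op_normP (dual_bl (x - y)) v) _.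
  by rewrite ler_wpM2r ?rnorm_ge0// -dual_rnorm ltW.
have ll : linear (l : E -> R[i]^o).
  move=> a u v; apply: (@cvg_unique R[i]^o (@norm_hausdorff _ _) _ _ _ _ (Hl _)).
  rewrite (_ : (fun x : E' => x (a *: u + v)) = (fun x : E' => a *: (x u : R[i]^o) + x v)); last first.
    by apply/funext => x; rewrite (dual_bl x).1.
  by apply: cvgD; [apply: cvgZr; exact: Hl|exact: Hl].
have [x1 Fx1] := cF _ (@ltr01 R).
have bl : bounded_linear (l : E -> R[i]^o).
  apply: (@bound_bounded_linear _ _ _ _ (op_norm x1 + 1)) => // v.
  rewrite -[l v](subrK (x1 v)) mulrDl addrC; apply: le_trans (rnormD _ _) _.
  by rewrite lerD ?(op_normP (dual_bl _))// rnormB key.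
have lP : (l : E -> R[i]^o) \in functionals E by rewrite inE.
apply/cvg_ex; exists (Dual lP); apply/(cvg_rnorm id) => e e0.
have e2 : 0 < e / 2 by rewrite divr_gt0.
have [x Fx] := cF _ e2; have xl := key _ _ e2 Fx.
apply: filterS Fx => y xy.
rewrite -[_ - _](subrKA x); apply: le_lt_trans (rnormD _ _) _.
rewrite [e]splitr ler_ltD// rnormB dual_rnorm; apply: op_norm_le.
- exact: (dual_bl (x - Dual lP)).1.
- exact: ltW.
- exact: xl.
Qed.
HB.instance Definition _ := Uniform_isComplete.Build E' dual_complete.
End dual.

Record closed_subspace (R : realType) (V : normedModType R[i]) := ClosedSubspace {
  closed_subspace_pred : {pred V};
  closed_subspace_submod : submod_closed closed_subspace_pred;
  closed_subspace_closed : closed [set x | x \in closed_subspace_pred] }.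

HB.instance Definition _ (R : realType) (V : normedModType R[i])
    (S : closed_subspace V) :=
  GRing.isSubmodClosed.Build _ _ (closed_subspace_pred S)
    (closed_subspace_submod S).

Record subspace_of (R : realType) (V : normedModType R[i])
    (S : closed_subspace V) := SubspaceOf {
  subspace_val :> V;
  subspace_valP : subspace_val \in closed_subspace_pred S }.

Section subspace_of.
Context {R : realType} {V : normedModType R[i]} (S : closed_subspace V).
Local Notation W := (subspace_of S).
HB.instance Definition _ := [isSub of W for @subspace_val R V S].
HB.instance Definition _ := [Choice of W by <:].
HB.instance Definition _ := [SubChoice_isSubLmodule of W by <:].

Let nm (x : W) : R[i] := `|subspace_val x|.
Let nmD (x y : W) : nm (x + y) <= nm x + nm y.
Proof. exact: ler_normD. Qed.
Let nmZ (a : R[i]) (x : W) : nm (a *: x) = `|a| * nm x.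
Proof. exact: normrZ. Qed.
Let nm0 (x : W) : nm x = 0 -> x = 0.
Proof. by move=> /normr0_eq0 x0; apply/val_inj. Qed.
HB.instance Definition _ := Lmodule_isNormed.Build R[i] W nmD nmZ nm0.
End subspace_of.

Section subspace_of_complete.
Context {R : realType} {V : completeNormedModType R[i]} (S : closed_subspace V).
Local Notation W := (subspace_of S).

Lemma subspace_of_complete (F : set_system W) :
  ProperFilter F -> cauchy F -> cvg F.
Proof.
move=> FF /cauchy_rnorm cF.
have : cvg (@subspace_val R V S @ F).
  apply: cauchy_cvg; apply/cauchy_rnorm => e /cF[x Fx].
  by exists (subspace_val x).
move=> /cvg_ex[l Fl].
have Sl : l \in closed_subspace_pred S.
  apply: (closed_cvg _ (@closed_subspace_closed _ _ S) _ _ Fl).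
  by apply: nearW => x; exact: subspace_valP.
apply/cvg_ex; exists (SubspaceOf Sl); apply/(cvg_rnorm id) => e e0.
exact: ((cvg_rnorm _ _).1 Fl e e0).
Qed.
HB.instance Definition _ := Uniform_isComplete.Build W subspace_of_complete.
End subspace_of_complete.

HB.mixin Record isLocallyCompactGroup G of PointedTopological G & Group G := {
  mulg_continuous : continuous (fun x : G * G => (x.1 * x.2)%g);
  invg_continuous : continuous (fun x : G => x^-1%g);
  lcgroup_hausdorff : hausdorff_space G;
  lcgroup_locally_compact : locally_compact [set: G] }.

#[short(type="lcGroupType")]
HB.structure Definition LocallyCompactGroup :=
  {G of PointedTopological G & Group G & isLocallyCompactGroup G}.

Record representation (R : realType) (G : lcGroupType) := Representation {
  rep_space : completeNormedModType R[i];
  rep_act :> G -> rep_space -> rep_space;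
  rep_bounded : forall g, bounded_linear (rep_act g);
  rep1 : forall x, rep_act 1%g x = x;
  repM : forall g h x, rep_act (g * h)%g x = rep_act g (rep_act h x);
  rep_continuous : forall x, continuous (fun g => rep_act g x) }.

Definition transpose (R : realType) (E F : normedModType R[i]) (T : E -> F)
    (bT : bounded_linear T) (xi : dual F) : dual E :=
  Dual (mem_set (comp_bounded_linear bT (dual_bl xi))).

Lemma transpose_bound (R : realType) (E F : normedModType R[i]) (T : E -> F)
    (bT : bounded_linear T) M : 0 <= M -> (forall x, rnorm (T x) <= M * rnorm x) ->
  forall xi, rnorm (transpose bT xi) <= M * rnorm xi.
Proof.
move=> M0 HM xi; rewrite !dual_rnorm; apply: op_norm_le.
- exact: (dual_bl (transpose bT xi)).1.
- by rewrite mulr_ge0// op_norm_ge0//; exact: dual_bl.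
- move=> x; apply: le_trans (op_normP (dual_bl xi) (T x)) _.
  rewrite -mulrA mulrCA; apply: ler_wpM2l (HM x).
  by apply: op_norm_ge0; exact: dual_bl.
Qed.

Lemma transpose_linear (R : realType) (E F : normedModType R[i]) (T : E -> F)
  (bT : bounded_linear T) : linear (transpose bT).
Proof. by move=> a xi eta; apply/val_inj/funext. Qed.

Section dual_representation.
Context {R : realType} {G : lcGroupType} (pi : representation R G).
Local Notation E := (rep_space pi).

Lemma rep_locally_bounded (g0 : G) : exists2 M, 0 <= M &
  \forall g \near g0, forall x : E, rnorm (pi g x) <= M * rnorm x.
Proof.
have [K /= nK [cK _]] := @lcgroup_locally_compact G g0 I.
have K0 : nbhs g0 K by move: nK; rewrite /within /=; apply: filterS => g; exact.
have [| |M M0 HM] := @uniform_boundedness R E E [set T | exists2 g, K g & T = pi g].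
- by move=> _ [g _ ->]; exact: rep_bounded.
- move=> x; have cf : continuous (fun g => rnorm (pi g x)).
    move=> g; apply/cvgrPdist_lt => e e0.
    apply: filterS ((cvg_rnorm _ _).1 (@rep_continuous _ _ pi x g) e e0) => h.
    by apply: le_lt_trans; exact: rnorm_dist.
  have /compact_bounded[M [_ HM]] :
      compact ((fun g => rnorm (pi g x)) @` K).
    by apply: continuous_compact => //; exact: continuous_subspaceT.
  exists (`|M| + 1) => _ [g Kg ->].
  apply: le_trans (ler_norm _) _; apply: (HM (`|M| + 1)).
    by rewrite ltr_pwDr// ler_norm.
  by exists g.
exists M => //; apply: filterS K0 => g Kg x.
by apply: HM; exists g.
Qed.

Definition contragredient (g : G) : dual E -> dual E :=
  transpose (rep_bounded pi g^-1%g).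

Lemma contragredientM g h xi :
  contragredient (g * h)%g xi = contragredient g (contragredient h xi).
Proof.
by apply/val_inj/funext => x /=; rewrite invgM repM.
Qed.

Definition continuous_orbit : {pred dual E} :=
  mem [set xi | continuous (fun g => contragredient g xi)].

Lemma continuous_orbit_submod : submod_closed continuous_orbit.
Proof.
split.
  apply: mem_set; rewrite /= (_ : (fun g => contragredient g 0) = cst 0).
  2: by apply/funext => g; exact: lin0 (@transpose_linear _ _ _ _ _).
  exact: cst_continuous.
move=> a xi eta /set_mem cxi /set_mem ceta; apply: mem_set.
rewrite /= (_ : (fun g => contragredient g (a *: xi + eta)) = (fun g => a *: contragredient g xi + contragredient g eta)); last first.
  by apply/funext => g; exact: transpose_linear.
move=> g; apply: cvgD; last exact: ceta.
by apply: cvgZr; exact: cxi.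
Qed.

Lemma continuous_orbit_closed : closed [set xi | xi \in continuous_orbit].
Proof.
move=> xi /= clxi; apply: mem_set => g0.
apply: (cvg_rnorm (fun g => contragredient g xi) _).2 => e e0.
have [M M0 HM] := rep_locally_bounded g0^-1%g.
have HM' : \forall g \near g0, forall x : E, rnorm (pi g^-1%g x) <= M * rnorm x.
  exact: (@invg_continuous G g0 _ HM).
have d0 : 0 < e / 3 / (M + 1) by rewrite !divr_gt0// ltr_wpDl.
have [eta [ceta xe]] : exists eta, eta \in continuous_orbit /\
    rnorm (xi - eta) < e / 3 / (M + 1).
  have nb := (@cvg_rnorm _ _ _ (nbhs xi) (nbhs_filter xi) id xi).1 (fun=> id) _ d0.
  by have [eta [ceta xe]] := clxi _ nb; exists eta.
have small g : (forall x : E, rnorm (pi g^-1%g x) <= M * rnorm x) ->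
    rnorm (contragredient g xi - contragredient g eta) < e / 3.
  move=> Hg; rewrite /contragredient -linB; last exact: transpose_linear.
  apply: le_lt_trans (transpose_bound _ M0 Hg _) _.
  apply: (@le_lt_trans _ _ ((M + 1) * rnorm (xi - eta))).
    by rewrite ler_wpM2r ?rnorm_ge0// lerDl.
  by rewrite mulrC -ltr_pdivlMr// ltr_wpDl.
have e3 : 0 < e / 3 by rewrite divr_gt0.
have s0 := small _ (nbhs_singleton HM').
apply: filterS2 HM' ((cvg_rnorm _ _).1 (set_mem ceta g0) _ e3) => g /small sg eg.
rewrite -(subrKA (contragredient g0 eta)) -[X in _ + X](subrKA (contragredient g eta)).
apply: le_lt_trans (rnormD _ _) _.
rewrite (_ : e = e / 3 + (e / 3 + e / 3)); last by field.
apply: ltrD => //; apply: le_lt_trans (rnormD _ _) _.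
by apply: ltrD => //; rewrite rnormB.
Qed.

(* The space of the dual representation: the functionals with a norm-continuous
   orbit map. *)
Definition dual_subspace : closed_subspace (dual E) :=
  ClosedSubspace continuous_orbit_submod continuous_orbit_closed.

Lemma contragredient_stable g xi : xi \in closed_subspace_pred dual_subspace ->
  contragredient g xi \in closed_subspace_pred dual_subspace.
Proof.
move=> /set_mem cxi; apply: mem_set => h /=.
rewrite (_ : (fun h => contragredient h (contragredient g xi)) = (fun h => contragredient h xi) \o (fun h => (h * g)%g)); last first.
  by apply/funext => k /=; rewrite contragredientM.
apply: continuous_comp; last exact: cxi.
apply: (@continuous_comp _ _ _ (fun k : G => (k, g)) (fun x : G * G => (x.1 * x.2)%g)).
  by apply: cvg_pair; [exact: cvg_id|exact: cvg_cst].
exact: mulg_continuous.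
Qed.

Definition dual_act g (xi : subspace_of dual_subspace) : subspace_of dual_subspace :=
  SubspaceOf (contragredient_stable g (subspace_valP xi)).

Lemma dual_act_bounded g : bounded_linear (dual_act g).
Proof.
have [M M0 HM] := bounded_linear_bound (rep_bounded pi g^-1%g).
apply: (@bound_bounded_linear _ _ _ _ M).
  by move=> a xi eta; apply/val_inj; exact: transpose_linear.
by move=> xi; exact: (transpose_bound (rep_bounded pi g^-1%g) M0 HM).
Qed.

Lemma dual_act1 xi : dual_act 1%g xi = xi.
Proof.
by apply/val_inj/val_inj/funext => x /=; rewrite invg1 rep1.
Qed.

Lemma dual_actM g h xi : dual_act (g * h)%g xi = dual_act g (dual_act h xi).
Proof. by apply/val_inj; exact: contragredientM. Qed.

Lemma dual_act_continuous xi : continuous (fun g => dual_act g xi).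
Proof.
move=> g; apply: (cvg_rnorm (fun g => dual_act g xi) _).2 => e e0.
exact: ((cvg_rnorm _ _).1 (set_mem (subspace_valP xi) g) e e0).
Qed.

Definition dual_rep : representation R G :=
  Representation dual_act_bounded dual_act1 dual_actM dual_act_continuous.

End dual_representation.

(* Classes of representations are predicates: the universe of representation R G
   is too large for set. *)
Definition rep_class (R : realType) (G : lcGroupType) :=
  representation R G -> Prop.

Definition dual_class (R : realType) (G : lcGroupType) (F : rep_class R G) :
    rep_class R G :=
  fun rho => exists2 pi, F pi & rho = dual_rep pi.

Definition compactly_generated (G : lcGroupType) : Prop :=
  exists2 K : set G, compact K &
    forall H : set G, H 1%g -> (forall x y, H x -> H y -> H (x * y)%g) ->
      (forall x, H x -> H x^-1%g) -> K `<=` H -> H = setT.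

Definition separable (T : topologicalType) : Prop :=
  exists2 D : set T, countable D & dense D.

Notation borel G := (g_sigma_algebraType (@open G)).

Record left_haar (R : realType) (G : lcGroupType)
    (mu : {measure set (borel G) -> \bar R}) : Prop := LeftHaar {
  haar_neq0 : mu setT <> 0%E;
  haar_invariant : forall (g : G) (B : set (borel G)), measurable B ->
    mu [set (g * x : G)%g | x in B] = mu B;
  haar_compact : forall K : set G, compact K -> (mu K < +oo)%E;
  haar_outer : forall B : set (borel G), measurable B ->
    mu B = ereal_inf [set mu U | U in [set U : set G | open U /\ B `<=` U]];
  haar_inner : forall U : set G, open U ->
    mu U = ereal_sup [set mu K | K in [set K : set G | compact K /\ K `<=` U]] }.

Definition Cc (R : realType) (G : lcGroupType) : set (G -> R[i]) :=
  [set f | continuous (f : G -> R[i]^o) /\ compact (closure [set x | f x != 0])].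
Arguments Cc : clear implicits.

Section group_algebra.
Context {R : realType} {G : lcGroupType}.
Variable mu : {measure set (borel G) -> \bar R}.
Implicit Types (f h : G -> R[i]) (F : rep_class R G).

Definition cintegral f : R[i] :=
  (\int[mu]_x complex.Re (f x)) +i* (\int[mu]_x complex.Im (f x)).

Definition convolution f h : G -> R[i] :=
  fun x => cintegral (fun y => f y * h (y^-1 * x)%g).

(* f~ is the element of Cc such that f~ dmu is the image of f dmu under
   inversion, as Radon measures, i.e. as functionals on Cc; explicitly f~ x is
   Delta(x^-1) * f x^-1 with Delta the modular function. *)
Definition reflection f : G -> R[i] :=
  xget (fun=> 0) [set f' | Cc R G f' /\ forall h, Cc R G h ->
    cintegral (fun x => h x * f' x) = cintegral (fun x => h x^-1%g * f x)].

(* pi(f)x is the vector-valued integral of f(g) pi(g)x dg, taken in the weak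
   sense: it is determined by the values of the functionals on it. *)
Definition rep_integral (pi : representation R G) f (x : rep_space pi) :
    rep_space pi :=
  get [set y | forall xi : dual (rep_space pi),
    xi y = cintegral (fun g => f g * xi (pi g x))].
Arguments rep_integral pi f x : clear implicits.

Definition bounded_on_compacts F : Prop :=
  forall K : set G, compact K -> exists M : R,
    forall pi g, F pi -> K g -> op_norm (pi g) <= M.

(* On Cc this supremum is finite when F is bounded on compacts. *)
Definition class_norm F f : R :=
  sup [set r : R | exists2 pi, F pi & r = op_norm (rep_integral pi f)].

Definition weakly_self_adjoint F : Prop :=
  exists2 c : R, 0 < c & forall f, Cc R G f ->
    class_norm (dual_class F) f <= c * class_norm F f /\
    class_norm F f <= c * class_norm (dual_class F) f.

(* (A, iota) is the Hausdorff completion of Cc for the seminorm class_norm F;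
   this determines it up to a unique isometric isomorphism. The values of iota
   outside Cc are irrelevant. *)
Record is_completion F (A : completeNormedModType R[i])
    (iota : (G -> R[i]) -> A) : Prop := IsCompletion {
  completion_linear : forall (a : R[i]) f h, Cc R G f -> Cc R G h ->
    iota (fun x => a * f x + h x) = a *: iota f + iota h;
  completion_norm : forall f, Cc R G f -> `|iota f| = (class_norm F f)%:C;
  completion_dense : dense [set iota f | f in Cc R G] }.

Section completion.
Context {A : completeNormedModType R[i]}.
Variable iota : (G -> R[i]) -> A.

Definition extends (V : normedModType R[i]) (u : (G -> R[i]) -> V)
    (T : A -> V) : Prop :=
  continuous T /\ forall f, Cc R G f -> T (iota f) = u f.

(* The continuous product of A that extends convolution; it is unique by
   density of Cc. *)
Definition completion_mul : A -> A -> A :=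
  get [set m : A -> A -> A | continuous (fun ab : A * A => m ab.1 ab.2) /\
    forall f h, Cc R G f -> Cc R G h ->
      m (iota f) (iota h) = iota (convolution f h)].

(* pi(a) for a in A: a |-> pi(a)x is the continuous extension of
   f |-> pi(f)x. *)
Definition completion_rep (pi : representation R G) (a : A) (x : rep_space pi) :
    rep_space pi :=
  (get [set T : A -> rep_space pi |
     extends (fun f => rep_integral pi f x) T]) a.
Arguments completion_rep pi a x : clear implicits.

Definition invariants (pi : representation R G) : set (rep_space pi) :=
  [set x | forall g, pi g x = x].
Arguments invariants pi : clear implicits.

Definition kazhdan_projection F (p : A) : Prop :=
  [/\ completion_mul p p = p,
      closure [set iota f | f in [set f | Cc R G f /\ cintegral f = 1]] p &
      forall pi, F pi -> range (completion_rep pi p) = invariants pi /\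
        forall x, completion_rep pi p (completion_rep pi p x) =
                  completion_rep pi p x].

Definition central (p : A) : Prop :=
  forall a, completion_mul p a = completion_mul a p.

Definition self_adjoint (a : A) : Prop :=
  exists2 T : A -> A, extends (fun f => iota (reflection f)) T & T a = a.

Definition conj_extends : Prop :=
  exists T : A -> A, extends (fun f => iota (fun x => conjc (f x))) T.

Definition real_element (a : A) : Prop :=
  exists2 T : A -> A, extends (fun f => iota (fun x => conjc (f x))) T & T a = a.

End completion.
End group_algebra.

(* Main.v *)
Require Import Defs.
From mathcomp Require Import all_boot all_order all_algebra complex ring lra finmap.
From mathcomp Require Import all_classical all_reals all_analysis measurable_realfun.

Set Implicit Arguments.
Unset Strict Implicit.
Unset Printing Implicit Defensive.

Import Order.TTheory GRing.Theory Num.Theory.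
Import numFieldNormedType.Exports.

Local Open Scope classical_set_scope.
Local Open Scope ring_scope.
Local Open Scope complex_scope.

(* Write [f~] for the reflection of [f] and [1(f)] for its integral. A Kazhdan
   projection [p] satisfies [f p = 1(f) p] for every [f] in Cc, because [pi(p)]
   has invariant range for every [pi] in the class. Weak self-adjointness makes
   [f |-> f~] extend to a bounded anti-multiplicative map of the completion, and
   [p~] then satisfies [p~ f = 1(f) p~]. Both [p] and [p~] are limits of
   functions of integral 1, so the product [p~ p] is equal to [p] and to [p~].
   Hence [p = p~] absorbs on both sides, which gives centrality; the same
   computation with the complex conjugate of [p] in place of [p~] gives reality.

   The reflection is [f~ x = f (x^-1) D x] with [D x] the integral of
   [phi (y x)] over [y], for a fixed [phi] of integral 1: this only needs
   left invariance and Fubini on Cc, not the uniqueness of Haar measure. *)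

(** * Hahn-Banach and extension by density *)

(** The analytic difficulty is the boundedness of reflection. It exchanges [pi] with its dual, but
    the space of the dual representation holds only the functionals with norm-continuous orbit, and
    these norm [rep_space pi] merely up to a constant. Averaging functionals near 1 bounds this
    constant uniformly over the class, and only then does comparing the class with its dual class
    bound f~.

    Conjugation differs from reflection in that it preserves the order of products: the conjugate of
    [p] absorbs on the same side as [p]. Reality therefore relies on the absorption on the other
    side that p = p~ provides.

    The integral pi(f)x, the product of [A] and pi(a) are chosen by [get] from a characterization.
    Each is shown to exist, by weak integration or by extension by density, and identities in [A]
    are then checked on Cc as closed conditions.

    Borel sets of G x G need not lie in the product sigma-algebra. Fubini on Cc is therefore derived
    from finite quadrature sums that are uniform in a parameter; the same sums produce the
    vector-valued integrals. *)

Section hahn_banach.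
Context {R : realType} {V : normedModType R}.
Implicit Types (A : set (V * R)) (x v : V).

(** Partial functionals below the norm are kept as sets of pairs, so that the union of a chain is
    again of this kind. Single-valuedness follows from domination: if two values at one point differ
    by t, then (0, t) and (0, -t) both lie in the set, so t is 0. *)
Definition dominated_graph A :=
  (forall a x r y s, A (x, r) -> A (y, s) -> A (a *: x + y, a * r + s)) /\
  (forall x r, A (x, r) -> r <= `|x|).

(** The value [c] at [v] must lie between all r - |x - v| and all |x + v| - r with (x, r) in [A]. By
    subadditivity each lower bound is below each upper bound, so the supremum of the lower ones
    works; homogeneity then covers multiples of [v] of either sign. *)
Lemma dominated_graph_extend A v : dominated_graph A -> A (0, 0) ->
  exists c, dominated_graph [set z | exists a x r, A (x, r) /\
    z = (x + a *: v, r + a * c)].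
Proof.
move=> [lA dA] A0.
pose B := [set t | exists x r, A (x, r) /\ t = r - `|x - v|].
have key x r x' r' : A (x, r) -> A (x', r') -> r' - `|x' - v| <= `|x + v| - r.
  move=> a a'; have /dA := lA 1 _ _ _ _ a a'; rewrite scale1r mul1r => H.
  have : `|x + x'| <= `|x + v| + `|x' - v|.
    by apply: le_trans (ler_normD _ _); rewrite addrACA subrr addr0.
  by lra.
have B0 : B !=set0 by exists (0 - `|0 - v|), 0, 0.
have ubB x r : A (x, r) -> ubound B (`|x + v| - r).
  by move=> a _ [x' [r' [a' ->]]]; exact: key a a'.
pose c := sup B; exists c.
have cle x r : A (x, r) -> r + c <= `|x + v|.
  by move=> a; have : c <= `|x + v| - r by [apply: ge_sup => //; exact: ubB]; lra.
have cge x r : A (x, r) -> r - c <= `|x - v|.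
  move=> a; have : r - `|x - v| <= c; last by lra.
  by apply: ub_le_sup; [exists (`|0 + v| - 0); exact: ubB|exists x, r].
have hom t x r : A (x, r) -> A (t *: x, t * r).
  by move=> a; have := lA t _ _ _ _ a A0; rewrite !addr0.
split.
  move=> a x r y s [t1 [x1 [r1 [a1 [-> ->]]]]] [t2 [x2 [r2 [a2 [-> ->]]]]].
  exists (a * t1 + t2), (a *: x1 + x2), (a * r1 + r2); split; first exact: lA.
  congr (_, _); last by ring.
  by rewrite scalerDr scalerDl !scalerA addrACA.
move=> _ _ [t [x [r [a [-> ->]]]]].
have [t0|t0|->] := ltgtP t 0; last by rewrite scale0r mul0r !addr0 dA.
- have t0' : 0 < - t by lra.
  have := cge _ _ (hom (- t)^-1 _ _ a).
  rewrite -(ler_pM2l t0') -[X in X * `|_|]gtr0_norm// -normrZ scalerBr scalerA.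
  rewrite divff ?gt_eqF// scale1r scaleNr opprK mulrBr mulrA divff ?gt_eqF// mul1r.
  by rewrite mulNr opprK.
- have := cle _ _ (hom t^-1 _ _ a).
  rewrite -(ler_pM2l t0) -[X in X * `|_|]gtr0_norm// -normrZ scalerDr scalerA.
  by rewrite divff ?gt_eqF// scale1r mulrDr mulrA divff ?gt_eqF// mul1r.
Qed.

Lemma hahn_banach_norming v : exists f : V -> R,
  [/\ forall a x y, f (a *: x + y) = a * f x + f y,
      forall x, f x <= `|x| & f v = `|v|].
Proof.
pose P A := A = set0 \/ (dominated_graph A /\ A (v, `|v|)).
have [F FP totF|A [PA maxA]] := @Zorn_bigcup (V * R)%type P.
  have [F0|] := pselect (forall X, F X -> X = set0).
    by left; rewrite -subset0 => z [X FX]; rewrite (F0 _ FX).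
  move=> /existsNP[X /not_implyP[FX X0]]; right.
  have gX Y : F Y -> Y !=set0 -> dominated_graph Y /\ Y (v, `|v|).
    by move=> /FP[->|//] /set0P/eqP.
  have Xn0 : X !=set0 by apply/set0P/eqP.
  split; last by exists X => //; apply: (gX _ FX Xn0).2.
  split=> [a x r y s [Y FY Yx] [Z FZ Zy]|x r [Y FY Yx]].
    have [gY _] := gX _ FY (ex_intro _ _ Yx).
    have [gZ _] := gX _ FZ (ex_intro _ _ Zy).
    have [YZ|ZY] := totF _ _ FY FZ.
      by exists Z => //; apply: gZ.1 => //; exact: YZ.
    by exists Y => //; apply: gY.1 => //; exact: ZY.
  by have [gY _] := gX _ FY (ex_intro _ _ Yx); exact: gY.2.
have [gA Av] : dominated_graph A /\ A (v, `|v|).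
  case: PA => // A0; exfalso.
  apply: (maxA [set z | exists a : R, z = (a *: v, a * `|v|)]).
    rewrite A0; split; last by move=> /(_ (v, `|v|)); apply; exists 1; rewrite scale1r mul1r.
    by [].
  right; split; last by exists 1; rewrite scale1r mul1r.
  split=> [a x r y s [b [-> ->]] [c [-> ->]]|x r [b [-> ->]]].
    by exists (a * b + c); rewrite scalerDl scalerA mulrDl mulrA.
  by rewrite normrZ ler_wpM2r// ler_norm.
have A0 : A (0, 0) by have := gA.1 (-1) _ _ _ _ Av Av; rewrite scaleN1r mulN1r !addNr.
have tot x : exists r, A (x, r).
  apply: contrapT => nx; have [c gc] := dominated_graph_extend x gA A0.
  apply: (maxA _ _ (or_intror (conj gc _))); last first.
    by exists 0, v, `|v|; rewrite scale0r mul0r !addr0.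
  split=> [[y r] Ay|/(_ (x, c)) H]; first by exists 0, y, r; rewrite scale0r mul0r !addr0.
  by apply: nx; exists c; apply: H; exists 1, 0, 0; rewrite scale1r mul1r !add0r.
have fun_A x r s : A (x, r) -> A (x, s) -> r = s.
  have half x' r' s' : A (x', r') -> A (x', s') -> r' <= s'.
    move=> a b; have /(gA.2) := gA.1 (-1) _ _ _ _ b a.
    by rewrite scaleN1r addNr normr0 mulN1r addrC subr_le0.
  by move=> a b; apply/eqP; rewrite eq_le !(half x).
have [f Af] := choice tot; exists f; split=> [a x y|x|].
- by apply: fun_A (Af _) _; exact: gA.1.
- by have := gA.2 _ _ (Af x).
- by apply: fun_A (Af _) _.
Qed.

End hahn_banach.

(** * Functionals on complex normed spaces: norming and separation *)

Section norming.
Context {R : realType} {E : normedModType R[i]}.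

Lemma rnormM (a b : R[i]) : rnorm (a * b : R[i]^o) = rnorm (a : R[i]^o) * rnorm (b : R[i]^o).
Proof. exact: (@rnormZ _ (R[i]^o) a b). Qed.

Lemma rnorm_real (r : R) : rnorm (r%:C : R[i]^o) = `|r|.
Proof. by rewrite /rnorm normc_def /= expr0n addr0 sqrtr_sqr. Qed.

(** The real functional [f] on [realify E] is complexified as f x - i f (i x), whose real part is
    [f]. Multiplying [x] by the unit scalar [u] that makes [xi x] real and nonnegative turns the
    bound on [f] into a bound on the modulus of [xi]. *)
Lemma norming_functional (y : E) : exists xi : dual E,
  (forall x, rnorm (xi x : R[i]^o) <= rnorm x) /\ rnorm y <= rnorm (xi y : R[i]^o).
Proof.
have [f [lf df fy]] := @hahn_banach_norming R (realify E) y.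
have lf' (a : R) (x z : E) : f (a%:C *: x + z) = a * f x + f z by exact: lf.
have fD (x z : E) : f (x + z) = f x + f z.
  by rewrite -[x]scale1r -(rmorph1 (real_complex R)) lf' rmorph1 scale1r mul1r.
have f0 : f 0 = 0 by have := fD 0 0; rewrite addr0 => ?; lra.
have fZ (a : R) (x : E) : f (a%:C *: x) = a * f x by rewrite -[_ *: _]addr0 lf' f0 addr0.
pose xi (x : E) : R[i]^o := f x +i* (- f ('i *: x)).
have iE : 'i * 'i = -1 :> R[i] by rewrite -expr2 sqr_i.
have lxi : linear xi.
  have add x z : xi (x + z) = xi x + xi z.
    by apply/eqP; rewrite eq_complex /= scalerDr !fD opprD !eqxx.
  have zR (a : R) x : xi (a%:C *: x) = a%:C * xi x.
    have -> : xi (a%:C *: x) = f (a%:C *: x) +i* (- f (a%:C *: ('i *: x))).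
      by rewrite /xi !scalerA [in 'i * _]mulrC.
    by apply/eqP; rewrite !fZ eq_complex /= !mul0r subr0 addr0 mulrN !eqxx.
  have zi x : xi ('i *: x) = 'i * xi x.
    have -> : xi ('i *: x) = f ('i *: x) +i* f x.
      rewrite /xi scalerA iE -(rmorphN1 (real_complex R)) fZ mulN1r opprK.
      by [].
    by apply/eqP; rewrite eq_complex /= !mul0r !mul1r sub0r opprK add0r !eqxx.
  move=> c x z; rewrite add; suff -> : xi (c *: x) = c *: xi x by [].
  case: c => a b; rewrite [a +i* b]complexE /= ['i * _]mulrC !scalerDl -!scalerA.
  by rewrite add !zR zi.
have bxi x : rnorm (xi x) <= rnorm x.
  have [->|n0] := eqVneq (xi x) 0; first by rewrite rnorm0 rnorm_ge0.
  pose u := ((rnorm (xi x))%:C / xi x : R[i]).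
  have ux : xi (u *: x) = (rnorm (xi x))%:C by rewrite (linZ lxi) [LHS]divfK.
  have u1 : rnorm (u : R[i]^o) = 1.
    apply/eqP; rewrite -(inj_eq (mulIf (_ : rnorm (xi x) != 0))).
      by rewrite -rnormM divfK// rnorm_real mul1r ger0_norm// rnorm_ge0.
    by apply: contra_neq n0 => /rnorm0_eq0.
  have /(congr1 (@complex.Re R)) /= <- := ux.
  by apply: le_trans (df _) _; rewrite [leLHS]rnormZ [X in X * _]u1 mul1r.
have xiP : (xi : E -> R[i]^o) \in functionals E.
  by rewrite inE; apply: (@bound_bounded_linear _ _ _ _ 1) => // x; rewrite mul1r.
exists (Dual xiP); split=> //=; apply: le_trans (Re_le_rnorm (xi y)).
by rewrite /= fy [leRHS]ger0_norm ?normr_ge0.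
Qed.

(** Vector-valued integrals are known only through their functionals, so norm estimates on them are
    reduced here to scalar ones. *)
Lemma rnorm_le_functionals (y : E) M : 
  (forall xi : dual E, (forall x, rnorm (xi x : R[i]^o) <= rnorm x) ->
    rnorm (xi y : R[i]^o) <= M) -> rnorm y <= M.
Proof.
by move=> H; have [xi [xi1 yxi]] := norming_functional y; exact: le_trans yxi (H _ xi1).
Qed.

Lemma functionals_separate (x y : E) : (forall xi : dual E, xi x = xi y) -> x = y.
Proof.
move=> H; apply/eqP; rewrite -subr_eq0; apply/eqP/rnorm0_eq0/eqP.
rewrite eq_le rnorm_ge0 andbT; apply: rnorm_le_functionals => xi _.
by rewrite (linB (dual_bl xi).1) H subrr rnorm0.
Qed.

End norming.

(** * Extension by density *)

Section density.
Context {R : realType}.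

Lemma closure_rnormP {V : normedModType R[i]} (S : set V) p :
  closure S p <-> forall e : R, 0 < e -> exists2 s, S s & rnorm (p - s) < e.
Proof.
split=> [cS e e0|H U /nbhs_ballP[e /= e0 Ue]].
  have [s [Ss ps]] := cS _ ((@cvg_rnorm _ V _ _ (nbhs_filter p) id p).1 (fun=> id) _ e0).
  by exists s.
move: e0; rewrite ltcE /= => /andP[/eqP ie re].
have [s Ss ps] := H _ re; exists s; split=> //; apply: Ue.
by rewrite -ball_normE /= rnormE ltcE /= ie eqxx.
Qed.

Lemma closure_eq {V W : normedModType R[i]} (S : set V) (f g : V -> W) p :
  continuous f -> continuous g -> (forall s, S s -> f s = g s) ->
  closure S p -> f p = g p.
Proof.
move=> cf cg fg Sp; apply/eqP; rewrite -subr_eq0; apply/eqP/rnorm0_eq0/eqP.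
rewrite eq_le rnorm_ge0 andbT; apply/ler_addgt0Pr => e e0; rewrite add0r ltW//.
have e2 : 0 < e / 2 by rewrite divr_gt0.
have [s [Ss [fs gs]]] :=
  Sp _ (filterI ((cvg_rnorm f _).1 (cf p) _ e2) ((cvg_rnorm g _).1 (cg p) _ e2)).
rewrite -[f p - _](subrKA (f s)) [X in rnorm (_ + (X - _))]fg// [e]splitr.
by apply: le_lt_trans (rnormD _ _) _; rewrite ltrD// rnormB.
Qed.

Lemma lipschitz_continuous {V W : normedModType R[i]} (T : V -> W) (C : R) :
  (forall a b, rnorm (T a - T b) <= C * rnorm (a - b)) -> continuous T.
Proof.
move=> HT a; apply: (cvg_rnorm T (T a)).2 => e e0.
have C0 : 0 < `|C| + 1 by rewrite ltr_wpDl.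
have d0 : 0 < e / (`|C| + 1) by rewrite divr_gt0.
apply: filterS ((@cvg_rnorm _ V _ _ (nbhs_filter a) id a).1 (fun=> id) _ d0) => b ab.
apply: le_lt_trans (HT _ _) _; apply: (@le_lt_trans _ _ ((`|C| + 1) * rnorm (a - b))).
  by rewrite ler_wpM2r ?rnorm_ge0// ler_wpDr// ler_norm.
by rewrite mulrC -ltr_pdivlMr.
Qed.

(** The domain carries no structure besides the distance pulled back along [i], which suits [iota]:
    it may identify functions and is meaningless outside Cc. The Lipschitz estimate forces [u] to
    factor through [i] on [D]. *)
Lemma dense_extension (T : Type) (D : set T) (V : normedModType R[i])
    (W : completeNormedModType R[i]) (i : T -> V) (u : T -> W) (C : R) :
  (forall a, closure [set i f | f in D] a) ->
  (forall f h, D f -> D h -> rnorm (u f - u h) <= C * rnorm (i f - i h)) ->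
  exists2 U : V -> W, forall a b, rnorm (U a - U b) <= `|C| * rnorm (a - b) &
    forall f, D f -> U (i f) = u f.
Proof.
move=> dD lu'.
have lu f h : D f -> D h -> rnorm (u f - u h) <= `|C| * rnorm (i f - i h).
  move=> Df Dh; apply: le_trans (lu' _ _ Df Dh) _.
  by rewrite ler_wpM2r ?rnorm_ge0// ler_norm.
(* The factor bounds the error of each approximation below: at most two distances are multiplied by
   |C|, and one more error comes from the limit in [W]. *)
have eps (x : R) : (forall e, 0 < e -> x <= (2 * `|C| + 1) * e) -> x <= 0.
  move=> H; apply/ler_addgt0Pr => e e0; rewrite add0r.
  have C0 : 0 < 2 * `|C| + 1 by rewrite ltr_wpDl// mulr_ge0.
  apply: le_trans (H (e / (2 * `|C| + 1)) _) _; first by rewrite divr_gt0.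
  by rewrite mulrC divfK// gt_eqF.
(* The value at [a] is pinned down by an inequality against all of [D], not by a sequence: agreement
   with [u] and the Lipschitz bound both follow from it. *)
have lim a : exists y, forall f, D f -> rnorm (u f - y) <= `|C| * rnorm (i f - a).
  have /choice[s Hs] n : exists f, D f /\ rnorm (a - i f) < n.+1%:R^-1.
    have n0 : 0 < n.+1%:R^-1 :> R by rewrite invr_gt0.
    by have [_ [f Df <-] af] := (closure_rnormP _ _).1 (dD a) _ n0; exists f.
  have small (e : R) : 0 < e -> \forall n \near \oo, rnorm (a - i (s n)) < e.
    move=> e0; have := near_infty_natSinv_lt (PosNum e0); apply: filterS => n /=.
    exact: lt_trans (Hs n).2.
  have /cauchy_cvg/cvg_ex[y uy] : cauchy ((u \o s) @ \oo).
    apply/cauchy_rnorm => e e0.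
    have d0 : 0 < e / (2 * `|C| + 1) by rewrite divr_gt0// ltr_wpDl// mulr_ge0.
    have [N _ HN] := small _ d0; exists (u (s N)); exists N => // n Nn /=.
    apply: le_lt_trans (lu _ _ (Hs _).1 (Hs _).1) _.
    have := HN _ Nn; have := HN N (leqnn N); rewrite /= !ltr_pdivlMr ?ltr_wpDl ?mulr_ge0//.
    have : rnorm (i (s N) - i (s n)) <= rnorm (a - i (s N)) + rnorm (a - i (s n)).
      by rewrite -[i _ - _](subrKA a) (le_trans (rnormD _ _))// [leLHS]addrC addrC lerD// rnormB.
    move: (rnorm_ge0 (a - i (s N))) (rnorm_ge0 (a - i (s n))) (normr_ge0 C).
    by move: (rnorm _) (rnorm _) (rnorm _) `|C| => x1 x2 x3 c; nra.
  exists y => f Df; rewrite -subr_le0; apply: eps => e e0.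
  have [n [ay uyn]] : exists n, rnorm (a - i (s n)) < e /\ rnorm (y - u (s n)) < e.
    by apply: (@filter_ex _ \oo); apply: filterI (small _ e0) ((cvg_rnorm _ _).1 uy _ e0).
  have := lu _ _ Df (Hs n).1.
  have : rnorm (u f - y) <= rnorm (u f - u (s n)) + rnorm (y - u (s n)).
    by rewrite -[u f - y](subrKA (u (s n))) (le_trans (rnormD _ _))// lerD// rnormB.
  have : rnorm (i f - i (s n)) <= rnorm (i f - a) + rnorm (a - i (s n)).
    by rewrite -[i f - _](subrKA a) (le_trans (rnormD _ _)).
  move: (normr_ge0 C) ay uyn; move: (rnorm _) (rnorm _) (rnorm _) (rnorm _) (rnorm _) (rnorm _).
  by move: `|C| => c x1 x2 x3 x4 x5 x6; nra.
have [U HU] := choice lim; exists U.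
  move=> a b; rewrite -subr_le0; apply: eps => e e0.
  have [_ [f Df <-] af] := (closure_rnormP _ _).1 (dD a) _ e0.
  have := HU a _ Df; have := HU b _ Df.
  have : rnorm (U a - U b) <= rnorm (u f - U a) + rnorm (u f - U b).
    by rewrite -[U a - _](subrKA (u f)) (le_trans (rnormD _ _))// lerD// rnormB.
  have : rnorm (i f - b) <= rnorm (i f - a) + rnorm (a - b).
    by rewrite -[i f - _](subrKA a) (le_trans (rnormD _ _)).
  rewrite [rnorm (i f - a)]rnormB.
  move: (normr_ge0 C) af; move: (rnorm _) (rnorm _) (rnorm _) (rnorm _) (rnorm _) (rnorm _).
  by move: `|C| => c x1 x2 x3 x4 x5 x6; nra.
move=> f Df; apply/eqP; rewrite -subr_eq0; apply/eqP/rnorm0_eq0/eqP.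
rewrite eq_le rnorm_ge0 andbT rnormB; apply: le_trans (HU _ _ Df) _.
by rewrite subrr rnorm0 mulr0.
Qed.

End density.

(** * Integration against a Radon measure *)

Notation cnorm := (@rnorm _ (_[i]^o)).

Section integration.
Context {R : realType} {G : lcGroupType}.
Variable mu : {measure set (borel G) -> \bar R}.
Implicit Types (f h : G -> R[i]) (g : G -> R) (K : set G).

Lemma compact_borel K : compact K -> measurable (K : set (borel G)).
Proof.
move=> /(compact_closed (@lcgroup_hausdorff G)) cK.
rewrite -[K]setCK; apply: measurableC; apply: sub_sigma_algebra.
exact: closed_openC.
Qed.

Lemma continuous_borel g : continuous g -> measurable_fun setT (g : borel G -> R).
Proof.
move=> /continuousP cg; apply: (measurability _ (RGenOInfty.measurableE R)).
move=> _ [_ [x ->] <-]; rewrite setTI; apply: sub_sigma_algebra.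
by apply: cg; exact: interval_open.
Qed.

Definition cintegrable f :=
  mu.-integrable setT (EFin \o (@complex.Re R \o f)) /\
  mu.-integrable setT (EFin \o (@complex.Im R \o f)).

Lemma cintegrableP (a : R[i]) f h : cintegrable f -> cintegrable h ->
  cintegrable (fun x => a * f x + h x).
Proof.
case: a => a b [f1 f2] [h1 h2]; split.
- rewrite (_ : _ \o _ = fun x =>
      ((a%:E * (EFin \o (@complex.Re R \o f)) x -
        b%:E * (EFin \o (@complex.Im R \o f)) x) + (EFin \o (@complex.Re R \o h)) x)%E).
    apply: integrableD => //; apply: integrableB => //; exact: integrableZl.
  by apply/funext => x /=; case: (f x) (h x) => u v [u' v'] /=.
- rewrite (_ : _ \o _ = fun x =>
      ((a%:E * (EFin \o (@complex.Im R \o f)) x +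
        b%:E * (EFin \o (@complex.Re R \o f)) x) + (EFin \o (@complex.Im R \o h)) x)%E).
    apply: integrableD => //; apply: integrableD => //; exact: integrableZl.
  by apply/funext => x /=; case: (f x) (h x) => u v [u' v'] /=.
Qed.

Lemma cintegral_linear (a : R[i]) f h : cintegrable f -> cintegrable h ->
  cintegral mu (fun x => a * f x + h x) = a * cintegral mu f + cintegral mu h.
Proof.
case: a => a b [f1 f2] [h1 h2].
have Zl c k : mu.-integrable setT (EFin \o k) ->
  mu.-integrable setT (EFin \o (fun x => c * k x)).
  by move=> ik; exact: (integrableZl _ c ik).
rewrite /cintegral; congr (_ +i* _).
- transitivity (\int[mu]_x ((a * complex.Re (f x) - b * complex.Im (f x)) + complex.Re (h x))).
    by apply: eq_Rintegral => x _; case: (f x) (h x) => u v [u' v'] /=.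
  rewrite RintegralD//; last by exact: (integrableB measurableT (Zl a _ f1) (Zl b _ f2)).
  by rewrite RintegralB// ?RintegralZl//; exact: Zl.
- transitivity (\int[mu]_x ((a * complex.Im (f x) + b * complex.Re (f x)) + complex.Im (h x))).
    by apply: eq_Rintegral => x _; case: (f x) (h x) => u v [u' v'] /=.
  rewrite RintegralD//; last by exact: (integrableD measurableT (Zl a _ f2) (Zl b _ f1)).
  by rewrite RintegralD// ?RintegralZl//; exact: Zl.
Qed.

Lemma cintegrable0 : cintegrable (fun=> 0).
Proof. by split; rewrite (_ : _ \o _ = cst 0%E)//; exact: integrable0. Qed.

Lemma cintegral0 : cintegral mu (fun=> 0) = 0.
Proof.
by rewrite /cintegral /Rintegral !integral0_eq.
Qed.

Lemma cintegrableZ (a : R[i]) f : cintegrable f -> cintegrable (fun x => a * f x).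
Proof.
move=> cf; have := cintegrableP a cf cintegrable0.
by congr cintegrable; apply/funext => x; rewrite addr0.
Qed.

Lemma cintegrableB f h : cintegrable f -> cintegrable h ->
  cintegrable (fun x => f x - h x).
Proof.
move=> cf ch; have := cintegrableP (-1) ch cf.
by congr cintegrable; apply/funext => x; rewrite mulN1r addrC.
Qed.

Lemma cintegralZ (a : R[i]) f : cintegrable f ->
  cintegral mu (fun x => a * f x) = a * cintegral mu f.
Proof.
move=> cf; have := cintegral_linear a cf cintegrable0.
by rewrite cintegral0 addr0 => <-; congr cintegral; apply/funext => x; rewrite addr0.
Qed.

Lemma cintegralB f h : cintegrable f -> cintegrable h ->
  cintegral mu (fun x => f x - h x) = cintegral mu f - cintegral mu h.
Proof.
move=> cf ch; rewrite addrC -mulN1r -cintegral_linear//.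
by congr cintegral; apply/funext => x; rewrite mulN1r addrC.
Qed.

Lemma cintegral_conj f : cintegrable f ->
  cintegral mu (fun x => conjc (f x)) = conjc (cintegral mu f).
Proof.
move=> [_ fi]; rewrite /cintegral /=.
have -> : \int[mu]_x complex.Re (conjc (f x)) = \int[mu]_x complex.Re (f x).
  by apply: eq_Rintegral => x _; case: (f x).
congr (_ +i* _); rewrite -mulN1r -RintegralZl//; apply: eq_Rintegral => x _.
by case: (f x) => a b /=; rewrite mulN1r.
Qed.

(** The unit scalar [u] rotates the integral onto the nonnegative half-line. Its modulus is then the
    integral of the real part of [u] times [f], which is at most [g] pointwise. *)
Lemma cintegral_le f g : cintegrable f -> mu.-integrable setT (EFin \o g) ->
  (forall x, cnorm (f x) <= g x) -> cnorm (cintegral mu f) <= \int[mu]_x g x.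
Proof.
move=> cf ig fg; have [->|n0] := eqVneq (cintegral mu f) 0.
  by rewrite rnorm0; apply: Rintegral_ge0 => x _; exact: le_trans (rnorm_ge0 _) (fg x).
have n0' : cnorm (cintegral mu f) != 0.
  by apply: contra_neq n0; exact: (@rnorm0_eq0 _ R[i]^o).
pose u := ((cnorm (cintegral mu f))%:C / cintegral mu f : R[i]).
have u1 : cnorm u = 1.
  apply/eqP; rewrite -(inj_eq (mulIf n0')) -rnormM divfK// rnorm_real mul1r.
  by rewrite ger0_norm// rnorm_ge0.
have : u * cintegral mu f = (cnorm (cintegral mu f))%:C by rewrite divfK.
rewrite -cintegralZ// => /(congr1 (@complex.Re R)) /= <-.
apply: le_Rintegral => //; first exact: (cintegrableZ u cf).1.
move=> x _; apply: le_trans (ler_norm _) _; apply: le_trans (Re_le_rnorm _) _.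
by rewrite rnormM u1 mul1r.
Qed.

Lemma cintegrable_restrict f (D : set (borel G)) : measurable D -> cintegrable f ->
  cintegrable (fun x => (\1_D x)%:C * f x).
Proof.
move=> mD [f1 f2]; split.
- have := (@integrable_mkcond _ (borel G) R mu D (EFin \o (@complex.Re R \o f)) mD).1
    (integrableS measurableT mD (@subsetT _ _) f1).
  congr (mu.-integrable _ _); apply/funext => x; rewrite patchE /= indicE.
  by case: (f x) => a b; case: ifPn => _ /=; rewrite ?mul1r ?mul0r ?subr0 ?subrr.
- have := (@integrable_mkcond _ (borel G) R mu D (EFin \o (@complex.Im R \o f)) mD).1
    (integrableS measurableT mD (@subsetT _ _) f2).
  congr (mu.-integrable _ _); apply/funext => x; rewrite patchE /= indicE.
  by case: (f x) => a b; case: ifPn => _ /=; rewrite ?mul1r ?mul0r ?addr0.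
Qed.

Lemma integrable_cst_indic (D : set (borel G)) (c : R) : measurable D ->
  (mu D < +oo)%E -> mu.-integrable setT (EFin \o (fun x => c * \1_D x)).
Proof.
move=> mD fD.
have iD : mu.-integrable D (EFin \o cst c).
  by apply: measurable_bounded_integrable => //; exact: bounded_cst.
have := (@integrable_mkcond _ (borel G) R mu D _ mD).1 iD; congr (mu.-integrable _ _).
apply/funext => x; rewrite patchE /= indicE.
by case: ifPn => _; rewrite ?mulr1 ?mulr0.
Qed.

Lemma Rintegral_cst_indic (D : set (borel G)) (c : R) : measurable D ->
  \int[mu]_x (c * \1_D x) = c * fine (mu D).
Proof.
move=> mD; rewrite -Rintegral_cst// [RHS]Rintegral_mkcond; apply: eq_Rintegral => x _.
by rewrite patchE indicE; case: ifPn => _; rewrite ?mulr1 ?mulr0.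
Qed.

Lemma cintegrable_cst_indic (D : set (borel G)) (c : R[i]) : measurable D ->
  (mu D < +oo)%E -> cintegrable (fun x => (\1_D x)%:C * c).
Proof.
move=> mD fD; case: c => a b; split.
- have := integrable_cst_indic a mD fD; congr (mu.-integrable _ _).
  by apply/funext => x /=; rewrite mul0r subr0 mulrC.
- have := integrable_cst_indic b mD fD; congr (mu.-integrable _ _).
  by apply/funext => x /=; rewrite mul0r addr0 mulrC.
Qed.

Lemma cintegral_cst_indic (D : set (borel G)) (c : R[i]) : measurable D ->
  cintegral mu (fun x => (\1_D x)%:C * c) = (fine (mu D))%:C * c.
Proof.
move=> mD; case: c => a b; apply/eqP; rewrite eq_complex /=.
rewrite !mul0r subr0 addr0 ![fine _ * _]mulrC -!Rintegral_cst_indic//.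
by apply/andP; split; apply/eqP/eq_Rintegral => x _; rewrite ?subr0 ?addr0 mulrC.
Qed.

Definition supported K f := forall x, ~ K x -> f x = 0.

Hypothesis hmu : left_haar mu.

Definition vol K : R := fine (mu (K : set (borel G))).

Lemma vol_ge0 K : 0 <= vol K. Proof. by rewrite fine_ge0. Qed.

Lemma continuous_cintegrable f K : continuous (f : G -> R[i]^o) -> compact K ->
  supported K f -> cintegrable f.
Proof.
move=> cf cK sf.
have H (h : R[i]^o -> R) : (forall z, `|h z| <= cnorm z) -> {morph h : x y / x - y} ->
    mu.-integrable setT (EFin \o (h \o f)).
  move=> hb hB.
  have h0 : h 0 = 0 by rewrite -[0 in LHS](subrr 0) hB subrr.
  have ch : continuous (h \o f : G -> R).
    move=> x; apply/cvgrPdist_lt => e e0.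
    apply: filterS ((cvg_rnorm (f : G -> R[i]^o) (f x)).1 (cf x) _ e0) => y fy /=.
    by rewrite -hB; apply: le_lt_trans (hb _) fy.
  have iK : mu.-integrable (K : set (borel G)) (EFin \o (h \o f)).
    apply: measurable_bounded_integrable => //.
    - exact: compact_borel.
    - exact: haar_compact.
    - exact: measurable_funTS (continuous_borel ch).
    - have /compact_bounded[M [rM HM]] : compact ((h \o f) @` K).
        by apply: continuous_compact => //; exact: continuous_subspaceT.
      by exists M; split=> // y My x Kx; apply: HM => //; exists x.
  have := (@integrable_mkcond _ (borel G) R mu K _ (compact_borel cK)).1 iK.
  congr (mu.-integrable _ _).
  apply/funext => x; rewrite patchE; case: ifPn => //= xK.
  by rewrite sf ?h0// => Kx; rewrite mem_set in xK.
split.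
  exact: (H _ (@Re_le_rnorm R) (fun x y => let: a +i* b := x in let: c +i* d := y in erefl)).
exact: (H _ (@Im_le_rnorm R) (fun x y => let: a +i* b := x in let: c +i* d := y in erefl)).
Qed.

Lemma cintegral_bound f K M : cintegrable f -> compact K ->
  supported K f -> (forall x, K x -> cnorm (f x) <= M) ->
  cnorm (cintegral mu f) <= M * vol K.
Proof.
move=> cf cK sf fM; have mK := compact_borel cK.
rewrite -Rintegral_cst_indic//; apply: cintegral_le => //.
  by apply: integrable_cst_indic => //; exact: haar_compact.
move=> x; rewrite indicE; have [Kx|nKx] := pselect (K x).
  by rewrite mem_set// mulr1; exact: fM.
by rewrite memNset// mulr0 sf// rnorm0.
Qed.

(** Left invariance says that the pushforward of [mu] by left translation is [mu]; the rest is
    change of variables in the real and imaginary parts. *)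
Lemma cintegral_transl f (a : G) : cintegrable f ->
  cintegral mu (fun x => f (a * x)%g) = cintegral mu f.
Proof.
move=> [f1 f2].
pose phi (x : borel G) : borel G := (a * x : G)%g.
have mphi : measurable_fun setT phi.
  apply: (measurability _ (erefl : _ = @measurable _ (borel G))) => _ [U oU <-].
  rewrite setTI; apply: sub_sigma_algebra.
  apply: (open_comp _ oU) => x _.
  apply: (@continuous_comp _ _ _ (fun k : G => (a, k)) (fun x : G * G => (x.1 * x.2)%g)).
    by apply: cvg_pair; [exact: cvg_cst|exact: cvg_id].
  exact: mulg_continuous.
have pE (B : set (borel G)) : measurable B -> pushforward mu phi B = mu B.
  move=> mB; have mp : measurable (phi @^-1` B) by rewrite -[_ @^-1` _]setTI; exact: mphi.
  rewrite /pushforward -(haar_invariant hmu a mp); congr (mu _).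
  apply/seteqP; split=> [_ [x /= Bx <-] //|x Bx].
  by exists (a^-1 * x)%g; [rewrite /preimage /phi /=; move: Bx; rewrite mulVKg|rewrite mulVKg].
have H (k : borel G -> R) : mu.-integrable setT (EFin \o k) ->
    \int[mu]_x k (phi x) = \int[mu]_x k x.
  move=> ik; have mk := measurable_int _ ik.
  have ip : (pushforward mu phi).-integrable setT (EFin \o k).
    move/integrableP : ik => [mk' fk]; apply/integrableP; split=> //.
    by rewrite (eq_measure_integral mu)// => B mB _; exact: pE.
  rewrite /Rintegral; congr fine.
  transitivity (\int[pushforward mu phi]_x (EFin \o k) x)%E; last first.
    by apply: eq_measure_integral => B mB _; exact: pE.
  rewrite (@integral_pushforward _ _ _ _ _ _ mphi mu setT (EFin \o k))//.
  move/integrableP : ip => [mk' fk]; apply/integrableP; split.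
    by rewrite preimage_setT; exact: measurableT_comp.
  move: fk; rewrite (ge0_integral_pushforward mphi)//.
  exact: measurableT_comp.
by rewrite /cintegral; congr (_ +i* _); apply: (H (fun x => _)).
Qed.

End integration.

(** Compactness of [B] makes the neighbourhood of [x0] uniform in [y]. This replaces dominated
    convergence, whose sequences do not suffice when [X] is not first countable. *)
Lemma tube (R : realType) (X Y : topologicalType) (k : X -> Y -> R[i]^o)
    (B : set Y) (x0 : X) :
  continuous (fun z : X * Y => k z.1 z.2) -> compact B ->
  (\forall x \near x0, forall y, ~ B y -> k x y = 0) ->
  forall e : R, 0 < e -> \forall x \near x0, forall y, cnorm (k x y - k x0 y) <= e.
Proof.
move=> ck /compact_near_coveringP cB sk e e0.
have e2 : 0 < e / 2 by rewrite divr_gt0.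
have H : \forall x \near x0, B `<=` [set y | cnorm (k x y - k x0 y) <= e].
  apply: (cB _ (nbhs x0) (fun x y => cnorm (k x y - k x0 y) <= e)) => y0 By0.
  have /= [[U V] [/= Ux Vy] UV] := (cvg_rnorm _ _).1 (ck (x0, y0)) _ e2.
  exists (V, U) => // -[y x] /= [Vyy Ux'].
  rewrite -[k x y - _](subrKA (k x0 y0)) [e]splitr; apply: le_trans (rnormD _ _) _.
  rewrite lerD//; first by rewrite rnormB ltW// (UV (x, y)).
  by rewrite ltW// (UV (x0, y))//; split=> //; exact: nbhs_singleton.
have s0 := nbhs_singleton sk.
apply: filterS2 H sk => x Hx sx y; have [/Hx //|nBy] := pselect (B y).
by rewrite s0// sx// subrr rnorm0 ltW.
Qed.

Section group_topology.
Context {G : lcGroupType}.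
Implicit Types A B : set G.

Lemma continuous_mulg_fun (T : topologicalType) (u v : T -> G) :
  continuous u -> continuous v -> continuous (fun t => u t * v t)%g.
Proof.
move=> cu cv t.
apply: (@continuous_comp _ _ _ (fun t => (u t, v t)) (fun x : G * G => (x.1 * x.2)%g)).
  by apply: cvg_pair; [exact: cu|exact: cv].
exact: mulg_continuous.
Qed.

Lemma continuous_invg_fun (T : topologicalType) (u : T -> G) :
  continuous u -> continuous (fun t => (u t)^-1)%g.
Proof.
move=> cu t; apply: (@continuous_comp _ _ _ u (fun x : G => x^-1%g)); first exact: cu.
exact: invg_continuous.
Qed.

Lemma compact_mulg A B : compact A -> compact B ->
  compact [set (x.1 * x.2)%g | x in A `*` B].
Proof.
move=> cA cB; apply: continuous_compact; last exact: compact_setX.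
by apply: continuous_subspaceT; exact: mulg_continuous.
Qed.

Lemma compact_invg A : compact A -> compact [set x^-1%g | x in A].
Proof.
move=> cA; apply: continuous_compact => //.
by apply: continuous_subspaceT; exact: invg_continuous.
Qed.

Lemma compact_nbhs (x : G) : exists2 K, nbhs x K & compact K.
Proof.
have [K /= nK [cK _]] := @lcgroup_locally_compact G x I; exists K => //.
by move: nK; rewrite /within /=; apply: filterS => g; exact.
Qed.

End group_topology.

(** * Parametric integrals, uniform quadrature and Fubini *)

Section radon.
Context {R : realType} {G : lcGroupType}.
Variable mu : {measure set (borel G) -> \bar R}.
Hypothesis hmu : left_haar mu.
Implicit Types (f h : G -> R[i]) (K : set G).
Local Notation intg := (cintegral mu).
Local Notation cint := (@cintegrable R G mu).
Local Notation vol := (vol mu).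

(** The support condition is local in [x]: for a kernel such as [phi (y * x)] the support in [y]
    moves with [x], and [B] may be chosen for each [x0]. *)
Lemma parametric_near (X : topologicalType) (k : X -> G -> R[i]^o) (B : set G) (x0 : X) :
  continuous (fun z : X * G => k z.1 z.2) -> compact B ->
  (\forall x \near x0, forall y, ~ B y -> k x y = 0) ->
  {for x0, continuous (fun x => intg (k x) : R[i]^o)}.
Proof.
move=> ck cB sk; apply: (cvg_rnorm (fun x => intg (k x) : R[i]^o) _).2 => e e0.
have v0 : 0 < vol B + 1 by rewrite ltr_wpDl// vol_ge0.
have d0 : 0 < e / (vol B + 1) by rewrite divr_gt0.
have ci x : (forall y, ~ B y -> k x y = 0) -> cint (k x).
  move=> sx; apply: (continuous_cintegrable hmu _ cB sx) => y.
  apply: (@continuous_comp _ _ _ (fun y => (x, y)) (fun z : X * G => k z.1 z.2)).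
    by apply: cvg_pair; [exact: cvg_cst|exact: cvg_id].
  exact: ck.
have s0 := nbhs_singleton sk.
apply: filterS2 (tube ck cB sk d0) sk => x kx sx.
rewrite rnormB -cintegralB; [|exact: ci..].
apply: (@le_lt_trans _ _ (e / (vol B + 1) * vol B)).
  apply: (cintegral_bound hmu _ cB) => //; first by apply: cintegrableB; exact: ci.
  by move=> y nBy; rewrite sx// s0// subrr.
by rewrite mulrAC ltr_pdivrMr// ltr_pM2l// ltrDl.
Qed.

(** Induction on the cover: the part of [D] in [W z] contributes the node [z], weighted by its
    measure, and the rest of [D] is left to the remaining sets. The pieces are disjoint, so the
    errors add up to [e] times the measure of [D]. *)
Lemma quadrature_cover (I : Type) (Phi : I -> G -> R[i]) (W : G -> set G) (e : R)
    (l : seq G) (D : set (borel G)) :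
  (forall z, open (W z)) -> (forall i, cint (Phi i)) ->
  (forall z i x, W z x -> cnorm (Phi i x - Phi i z) <= e) ->
  measurable D -> (mu D < +oo)%E -> D `<=` [set x | exists2 z, z \in l & W z x] ->
  exists2 q : seq (R * G), all (fun p => 0 <= p.1) q &
    forall i, cnorm (intg (fun x => (\1_D x)%:C * Phi i x) -
                     \sum_(p <- q) p.1%:C * Phi i p.2) <= e * fine (mu D).
Proof.
move=> oW iPhi PhiW; elim: l D => [|z l IH] D mD fD DW.
  have D0 : D = set0 by rewrite -subset0 => x /DW[].
  exists [::] => // i; rewrite big_nil subr0 D0 measure0 /= mulr0.
  by under [X in intg X]eq_fun do rewrite indic0 mul0r; rewrite cintegral0 rnorm0.
have mW : measurable (W z : set (borel G)) by apply: sub_sigma_algebra; exact: oW.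
have mDW := measurableI _ _ mD mW; have mD' := measurableD mD mW.
have le (S : set (borel G)) : measurable S -> S `<=` D -> (mu S < +oo)%E.
  by move=> mS SD; apply: le_lt_trans fD; apply: le_measure; rewrite ?inE.
have fDW := le _ mDW (@subIsetl _ _ _); have fD' := le _ mD' (@subDsetl _ _ _).
have [|q q0 Hq] := IH _ mD' fD'.
  move=> x [Dx nWx]; have [z' + Wz'] := DW _ Dx.
  by rewrite in_cons => /predU1P[zz|zl]; [rewrite zz in Wz'|exists z'].
exists ((fine (mu (D `&` W z)), z) :: q); first by rewrite /= q0 fine_ge0.
move=> i; rewrite big_cons /=.
have -> : fine (mu D) = fine (mu (D `&` W z)) + fine (mu (D `\` W z)).
  rewrite -fineD ?ge0_fin_numE// -measureU//; first by rewrite setUIDK.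
  by apply/seteqP; split=> x // [[_ ?] [_]].
have -> : intg (fun x => (\1_D x)%:C * Phi i x) =
    intg (fun x => (\1_(D `&` W z) x)%:C * Phi i x) +
    intg (fun x => (\1_(D `\` W z) x)%:C * Phi i x).
  rewrite -[X in X + _]mul1r -cintegral_linear; [|exact: cintegrable_restrict..].
  congr (cintegral _ _); apply/funext => x; rewrite mul1r -mulrDl; congr (_ * _).
  rewrite -rmorphD /=; congr (_%:C); rewrite !indicE !in_setI in_setC.
  by case: (x \in D); case: (x \in W z); rewrite /= ?addr0 ?add0r.
rewrite mulrDr opprD addrACA; apply: le_trans (rnormD _ _) _; apply: lerD (Hq i).
rewrite -cintegral_cst_indic// -cintegralB;
  [|exact: cintegrable_restrict|exact: cintegrable_cst_indic].
rewrite -Rintegral_cst_indic//; apply: cintegral_le.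
- by apply: cintegrableB; [exact: cintegrable_restrict|exact: cintegrable_cst_indic].
- exact: integrable_cst_indic.
- move=> x; rewrite -mulrBr rnormM rnorm_real indicE; have [|] := boolP (x \in _).
    by rewrite in_setI => /andP[_ /set_mem Wx]; rewrite normr1 mul1r mulr1 PhiW.
  by rewrite normr0 mul0r mulr0.
Qed.

(** The point is that nodes and weights do not depend on [i]. The index runs over the slices of a
    kernel in [fubini] and over the contractive functionals in [weak_integral]. *)
Lemma quadrature (I : Type) (Phi : I -> G -> R[i]) K (e : R) :
  compact K -> (forall i, cint (Phi i)) -> (forall i, supported K (Phi i)) ->
  (forall z, \forall x \near z, forall i, cnorm (Phi i x - Phi i z) <= e) ->
  exists2 q : seq (R * G), all (fun p => 0 <= p.1) q &
    forall i, cnorm (intg (Phi i) - \sum_(p <- q) p.1%:C * Phi i p.2) <= e * vol K.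
Proof.
move=> cK iPhi sPhi ePhi.
pose W z := interior [set x | forall i, cnorm (Phi i x - Phi i z) <= e].
have := cK; rewrite compact_cover => /(_ G setT W (fun z _ => open_interior _))[|l _ Kl].
  by move=> x _; exists x => //; exact: ePhi.
have [|||||q q0 Hq] := @quadrature_cover I Phi W e l K _ iPhi.
- by move=> z; exact: open_interior.
- by move=> z i x /interior_subset; exact.
- exact: compact_borel.
- exact: haar_compact.
- by move=> x /Kl[z /= zl Wz]; exists z.
exists q => // i; have := Hq i; congr (cnorm (_ - _) <= _).
congr (cintegral _ _); apply/funext => x; rewrite indicE; have [//|] := boolP (x \in K).
  by rewrite mul1r.
by move=> xK; rewrite mul0r sPhi// => Kx; rewrite mem_set in xK.
Qed.

Lemma cintegral_sum (T : Type) (q : seq T) (w : T -> R[i]) (k : T -> G -> R[i]) :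
  (forall t, cint (k t)) ->
  cint (fun x => \sum_(t <- q) w t * k t x) /\
  intg (fun x => \sum_(t <- q) w t * k t x) = \sum_(t <- q) w t * intg (k t).
Proof.
move=> ik; elim: q => [|t q [iq eq]].
  have -> : (fun x => \sum_(t <- [::]) w t * k t x) = fun=> 0.
    by apply/funext => x; rewrite big_nil.
  by rewrite big_nil; split; [exact: cintegrable0|exact: cintegral0].
have -> : (fun x => \sum_(s <- t :: q) w s * k s x) =
    (fun x => w t * k t x + \sum_(s <- q) w s * k s x).
  by apply/funext => x; rewrite big_cons.
by rewrite big_cons; split; [exact: cintegrableP|rewrite cintegral_linear// eq].
Qed.

(** One quadrature in [y] serves all slices [k x] and also the marginal of [k] in [y]. Integrated
    over [x], the sum for the slices becomes exactly the sum for the marginal, so both iterated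
    integrals are close to the same number. *)
Lemma fubini (k : G -> G -> R[i]^o) (A B : set G) :
  continuous (fun z : G * G => k z.1 z.2) -> compact A -> compact B ->
  (forall x y, ~ A x -> k x y = 0) -> (forall x y, ~ B y -> k x y = 0) ->
  intg (fun x => intg (k x)) = intg (fun y => intg (k^~ y)).
Proof.
move=> ck cA cB sA sB.
have ck' : continuous (fun z : G * G => k z.2 z.1).
  move=> z; apply: (@continuous_comp _ _ _ (fun z : G * G => (z.2, z.1))
    (fun z : G * G => k z.1 z.2)).
    by apply: cvg_pair; [exact: cvg_snd|exact: cvg_fst].
  exact: ck.
have cx x : continuous (k x).
  move=> y; apply: (@continuous_comp _ _ _ (fun y => (x, y)) (fun z : G * G => k z.1 z.2)).
    by apply: cvg_pair; [exact: cvg_cst|exact: cvg_id].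
  exact: ck.
have cy y : continuous (k^~ y).
  move=> x; apply: (@continuous_comp _ _ _ (fun x => (x, y)) (fun z : G * G => k z.1 z.2)).
    by apply: cvg_pair; [exact: cvg_id|exact: cvg_cst].
  exact: ck.
have ix x : cint (k x) by exact: (continuous_cintegrable hmu (cx x) cB (sB x)).
have iy y : cint (k^~ y) by exact: (continuous_cintegrable hmu (cy y) cA (sA^~ y)).
have c1 : continuous (fun x => intg (k x) : R[i]^o).
  by move=> x; apply: (parametric_near ck cB); exact: nearW.
have c2 : continuous (fun y => intg (k^~ y) : R[i]^o).
  move=> y; apply: (@parametric_near _ (fun y x => k x y) A) => //.
  by apply: nearW => ? ?; exact: sA.
have s1 : supported A (fun x => intg (k x)).
  move=> x nA; rewrite -(cintegral0 mu); congr (cintegral _ _).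
  by apply/funext => y; exact: sA.
have s2 : supported B (fun y => intg (k^~ y)).
  move=> y nB; rewrite -(cintegral0 mu); congr (cintegral _ _).
  by apply/funext => x; exact: sB.
have i1 := continuous_cintegrable hmu c1 cA s1.
have i2 := continuous_cintegrable hmu c2 cB s2.
apply/eqP; rewrite -subr_eq0; apply/eqP; apply: (@rnorm0_eq0 _ R[i]^o).
apply/eqP; rewrite eq_le rnorm_ge0 andbT; apply/ler_addgt0Pr => d d0; rewrite add0r.
have v0 : 0 < vol A + 1 by rewrite ltr_wpDl// vol_ge0.
have w0 : 0 < vol B + 1 by rewrite ltr_wpDl// vol_ge0.
pose e := d / ((vol A + 1) * (vol B + 1)).
have e0 : 0 < e by rewrite divr_gt0// mulr_gt0.
(* The first term controls the slices; the second controls the marginal, where integration over [A]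
   costs a factor [vol A]. *)
pose e' := Num.min e (e / (vol A + 1)).
have e'0 : 0 < e' by rewrite lt_min e0 divr_gt0.
(* [None] indexes the marginal, so that it shares nodes and weights with the slices. *)
pose Phi (i : option G) := if i is Some x then k x else fun y => intg (k^~ y).
have [q _ Hq] : exists2 q : seq (R * G), all (fun p => 0 <= p.1) q &
    forall i, cnorm (intg (Phi i) - \sum_(p <- q) p.1%:C * Phi i p.2) <= e * vol B.
  apply: quadrature => //; first by case.
    by case.
  move=> z; have sz : \forall y \near z, forall x, ~ A x -> k x y = 0.
    by apply: nearW => y x; exact: sA.
  have := @tube _ _ _ (fun y x => k x y) A z ck' cA sz _ e'0.
  apply: filterS => y Hy [x|] /=.
    by apply: le_trans (Hy x) _; rewrite ge_min lexx.
  rewrite -cintegralB//; apply: (@le_trans _ _ (e' * vol A)).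
    apply: (cintegral_bound hmu _ cA) => //; first exact: cintegrableB.
    by move=> x nA; rewrite !sA// subrr.
  apply: (@le_trans _ _ (e / (vol A + 1) * (vol A + 1))); last by rewrite divfK// gt_eqF.
  by apply: ler_pM; rewrite ?vol_ge0 ?(ltW e'0)// ?lerDl// ge_min lexx orbT.
have [iS eS] := @cintegral_sum _ q (fun p => p.1%:C) (fun p => k^~ p.2) (fun p => iy p.2).
rewrite -(subrKA (\sum_(p <- q) p.1%:C * intg (k^~ p.2))).
apply: le_trans (rnormD _ _) _; rewrite [X in _ + X]rnormB.
apply: (@le_trans _ _ (e * vol B * vol A + e * vol B)).
  apply: lerD; last exact: (Hq None).
  rewrite -eS -cintegralB//; apply: (cintegral_bound hmu _ cA) => //.
  - exact: cintegrableB.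
  - by move=> x nA; rewrite s1// big1 ?subrr// => p _; rewrite sA ?mulr0.
  - by move=> x _; exact: (Hq (Some x)).
have -> : d = e * ((vol A + 1) * (vol B + 1)) by rewrite divfK// gt_eqF// mulr_gt0.
move: (vol_ge0 mu A) (vol_ge0 mu B) e0.
move: (vol A) (vol B) e {e' e'0 Hq} => a b c a0 b0 c0; by have := mulr_ge0 (ltW c0) a0; nra.
Qed.

End radon.

(** * Compactly supported functions and Haar measure *)

Lemma continuous_real_complex (R : realType) (T : topologicalType) (g : T -> R) :
  continuous g -> continuous (fun x => (g x)%:C : R[i]^o).
Proof.
move=> cg x; apply: (cvg_rnorm (fun x => (g x)%:C : R[i]^o) _).2 => e e0.
have /cvgrPdist_lt/(_ _ e0) := cg x; apply: filterS => y.
by rewrite -rmorphB /= rnorm_real.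
Qed.

Lemma continuous_pair_comp (X Y Z : topologicalType) (k : X * Y -> Z) (T : topologicalType)
    (u : T -> X) (v : T -> Y) :
  continuous k -> continuous u -> continuous v -> continuous (fun t => k (u t, v t)).
Proof.
move=> ck cu cv t; apply: (@continuous_comp _ _ _ (fun t => (u t, v t)) k); last exact: ck.
by apply: cvg_pair; [exact: cu|exact: cv].
Qed.

Section Cc.
Context {R : realType} {G : lcGroupType}.
Implicit Types (f h : G -> R[i]) (K : set G).

Lemma CcP f : Cc R G f <-> exists K, [/\ continuous (f : G -> R[i]^o), compact K & supported K f].
Proof.
split=> [[cf cK]|[K [cf cK sf]]].
  exists (closure [set x | f x != 0]); split=> // x nx; apply/eqP; apply: contra_notT nx => fx.
  exact: subset_closure.
split=> //; apply: subclosed_compact (cK) _; first exact: closed_closure.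
rewrite (closureE) => x; apply; split; last first.
  by move=> y /= fy; apply: contrapT => /sf/eqP; rewrite (negbTE fy).
exact: (compact_closed (@lcgroup_hausdorff G) cK).
Qed.

Lemma Cc_linear (a : R[i]) f h : Cc R G f -> Cc R G h -> Cc R G (fun x => a * f x + h x).
Proof.
move=> /CcP[K [cf cK sf]] /CcP[L [ch cL sh]]; apply/CcP; exists (K `|` L); split.
- move=> x; apply: (@cvgD _ (R[i]^o)); last exact: ch.
  by apply: (@cvgM R[i] G); [exact: cvg_cst|exact: cf].
- exact: compactU.
- by move=> x /not_orP[/sf -> /sh ->]; rewrite mulr0 addr0.
Qed.

Lemma Cc0 : Cc R G (fun=> 0).
Proof. by apply/CcP; exists set0; split=> //; [move=> x; exact: cvg_cst|exact: compact0]. Qed.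

Lemma CcZ (a : R[i]) f : Cc R G f -> Cc R G (fun x => a * f x).
Proof.
move=> cf; have := Cc_linear a cf Cc0.
by congr (Cc R G); apply/funext => x; rewrite addr0.
Qed.

Lemma CcB f h : Cc R G f -> Cc R G h -> Cc R G (fun x => f x - h x).
Proof.
move=> cf ch; have := Cc_linear (-1) ch cf.
by congr (Cc R G); apply/funext => x; rewrite mulN1r addrC.
Qed.

Lemma CcMr f h : Cc R G f -> continuous (h : G -> R[i]^o) -> Cc R G (fun x => f x * h x).
Proof.
move=> /CcP[K [cf cK sf]] ch; apply/CcP; exists K; split; [|exact: cK|].
- by move=> x; apply: (@cvgM R[i] G); [exact: cf|exact: ch].
- by move=> x /sf ->; rewrite mul0r.
Qed.

Lemma Cc_inv f : Cc R G f -> Cc R G (fun x => f x^-1%g).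
Proof.
move=> /CcP[K [cf cK sf]]; apply/CcP; exists [set x^-1%g | x in K]; split.
- move=> x; apply: (@continuous_comp _ _ _ (fun x : G => x^-1%g)); last exact: cf.
  exact: invg_continuous.
- exact: compact_invg.
- by move=> x nx; apply: sf => Kx; apply: nx; exists x^-1%g => //; rewrite invgK.
Qed.

Lemma Cc_conj f : Cc R G f -> Cc R G (fun x => conjc (f x)).
Proof.
move=> /CcP[K [cf cK sf]]; apply/CcP; exists K; split; [|exact: cK|].
- move=> x; apply: (cvg_rnorm (fun x => conjc (f x) : R[i]^o) _).2 => e e0.
  apply: filterS ((cvg_rnorm (f : G -> R[i]^o) _).1 (cf x) _ e0) => y.
  by rewrite -rmorphB /rnorm /=; case: (f x - f y) => a b /=; rewrite sqrrN.
- by move=> x /sf ->; rewrite rmorph0.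
Qed.

End Cc.

(** * Positivity of Haar measure on open sets and bump functions *)

Section haar.
Context {R : realType} {G : lcGroupType}.
Variable mu : {measure set (borel G) -> \bar R}.
Hypothesis hmu : left_haar mu.
Implicit Types (f h : G -> R[i]) (K : set G).
Local Notation intg := (cintegral mu).
Local Notation cint := (@cintegrable R G mu).

Lemma Cc_cintegrable f : Cc R G f -> cint f.
Proof. by move=> /CcP[K [cf cK sf]]; exact: continuous_cintegrable cf cK sf. Qed.

(** If [U] were null, so would be its translates. Finitely many of them cover any given compact set,
    and inner regularity would make [mu] zero. *)
Lemma haar_open_gt0 (U : set G) : open U -> U !=set0 -> (0 < mu (U : set (borel G)))%E.
Proof.
move=> oU [u Uu]; rewrite lt0e measure_ge0 andbT; apply/eqP => U0.
apply: (haar_neq0 hmu); apply/eqP; rewrite eq_le measure_ge0 andbT.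
rewrite (haar_inner hmu openT); apply: ge_ereal_sup => _ [K [cK _] <-].
pose W (g : G) : set G := [set x | U (g^-1 * x)%g].
have oW g : open (W g).
  apply: (open_comp _ oU) => x _.
  by apply: continuous_mulg_fun => t; [exact: cvg_cst|exact: cvg_id].
have W0 g : mu (W g : set (borel G)) = 0%E.
  rewrite -U0 -(@haar_invariant _ _ _ hmu g U); last exact: sub_sigma_algebra.
  congr (mu _); apply/seteqP; split=> [x Ux|_ [x Ux <-]].
    by exists (g^-1 * x)%g => //; rewrite mulVKg.
  by rewrite /W /= mulKg.
have := cK; rewrite compact_cover => /(_ G setT W (fun z _ => oW z))[|l _ Kl].
  by move=> x _; exists (x * u^-1)%g => //; rewrite /W /= invgM invgK mulgVK.
apply: (@le_trans _ _ (\sum_(g <- finmap.enum_fset l) mu (W g : set (borel G)))%E).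
  apply: (@le_trans _ _ (mu (\big[setU/set0]_(g <- finmap.enum_fset l) (W g : set (borel G))))).
    apply: le_measure; rewrite ?inE.
    - exact: compact_borel.
    - by apply: bigsetU_measurable => g _; apply: sub_sigma_algebra.
    - by move=> x /Kl[g /= gl Wx]; rewrite -bigcup_seq; exists g.
  elim: (finmap.enum_fset l) => [|g s IH]; first by rewrite !big_nil measure0.
  rewrite !big_cons; apply: le_trans (measureU2 _ _ _) _.
  - by apply: sub_sigma_algebra.
  - by apply: bigsetU_measurable => i _; apply: sub_sigma_algebra.
  - exact: leeD2l.
by rewrite big1// => g _; exact: W0.
Qed.

(** Complete regularity separates [x] from the complement of the interior of a compact neighbourhood
    inside [U]. The resulting function exceeds 1/2 on a nonempty open set, so its integral is
    positive and can be normalized. *)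
Lemma haar_bump (x : G) (U : set G) : nbhs x U -> exists g K,
  [/\ [/\ compact K, K `<=` U & supported K (fun y => (g y)%:C)],
     continuous (fun y => (g y)%:C : R[i]^o),
     forall y, 0 <= g y & \int[mu]_y g y = 1].
Proof.
move=> xU; have [K xK cK] := compact_nbhs x.
have crG := @locally_compact_completely_regular G R
  (@lcgroup_locally_compact G) (@lcgroup_hausdorff G).
have [V xV VUK] : exists2 V, nbhs x V & closed V /\ V `<=` U `&` K.
  have regG : regular_space G.
    exact: (@completely_regular_regular R _ crG).
  have [V xV clV] := regG x _ (filterI xU xK).
  exists (closure V); first by apply: filterS xV; exact: subset_closure.
  by split=> //; exact: closed_closure.
have [clV sV] := VUK.
have cV : compact V by apply: subclosed_compact cK _ => // y /sV[].
have := crG x (~` interior V).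
case; first by apply: open_closedC; exact: open_interior.
  by move=> nV; apply: nV; exact: xV.
move=> uT H; have /uniform_separatorP : uniform_separator [set x] (~` interior V) by exists uT.
move=> /(_ R)[g0 [cg0 g01 g0x g0V]].
pose g1 y : R := 1 - g0 y.
have cg1 : continuous g1 by move=> y; apply: cvgB; [exact: cvg_cst|exact: cg0].
have g1x : g1 x = 1 by rewrite /g1 (g0x (g0 x))// ?subr0//; exists x.
have g1ge0 y : 0 <= g1 y.
  rewrite subr_ge0; have := g01 (g0 y) (ex_intro2 _ _ y I erefl).
  by rewrite /= in_itv /= => /andP[].
have g1V y : ~ V y -> g1 y = 0.
  move=> nVy; rewrite /g1 (g0V (g0 y)) ?subrr//; exists y => // /interior_subset; exact: nVy.
have sV1 : supported V (fun y => (g1 y)%:C) by move=> y /g1V ->.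
have cC := continuous_real_complex cg1.
have [ig _] := continuous_cintegrable hmu cC cV sV1.
have Ig : 0 < \int[mu]_y g1 y.
  pose W := [set y | 1/2 < g1 y].
  have oW : open W by apply: (open_comp _ (@open_gt R (1/2))) => y _; exact: cg1.
  have WV : W `<=` V.
    move=> y Wy; apply: contrapT => /g1V y0; move: Wy; rewrite /W /= y0.
    by rewrite ltNge mulr_ge0// invr_ge0.
  have mW : measurable (W : set (borel G)) by apply: sub_sigma_algebra.
  have fW : (mu (W : set (borel G)) < +oo)%E.
    apply: le_lt_trans (haar_compact hmu cV); apply: le_measure; rewrite ?inE//.
    exact: compact_borel.
  apply: (@lt_le_trans _ _ (1/2 * fine (mu (W : set (borel G))))).
    rewrite mulr_gt0// ?divr_gt0// fine_gt0// fW andbT; apply: haar_open_gt0 => //.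
    by exists x; rewrite /W /= g1x; lra.
  rewrite -Rintegral_cst_indic//; apply: le_Rintegral => //.
    exact: integrable_cst_indic.
  move=> y _; rewrite indicE; have [/set_mem|_] := boolP (y \in _).
    by rewrite mulr1 /W /=; exact: ltW.
  by rewrite mulr0; exact: g1ge0.
exists (fun y => (\int[mu]_y g1 y)^-1 * g1 y), V; split.
- split=> //; first by move=> y /sV[].
  by move=> y /g1V ->; rewrite mulr0.
- apply: continuous_real_complex => y; apply: cvgM; first exact: cvg_cst.
  exact: cg1.
- by move=> y; rewrite mulr_ge0// invr_ge0 ltW.
- by rewrite RintegralZl// mulVf// gt_eqF.
Qed.

Lemma cintegral_real (g : G -> R) : intg (fun y => (g y)%:C) = (\int[mu]_y g y)%:C.
Proof.
rewrite /cintegral /=; congr (_ +i* _).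
by rewrite /Rintegral integral0_eq.
Qed.

(* Testing against bump functions of integral 1 concentrated near x recovers f x. *)
Lemma Cc_separated f : continuous (f : G -> R[i]^o) ->
  (forall h, Cc R G h -> intg (fun x => h x * f x) = 0) -> forall x, f x = 0.
Proof.
move=> cf H x; apply: (@rnorm0_eq0 _ R[i]^o); apply/eqP/negPn/negP => n0.
have p0 : 0 < cnorm (f x) by rewrite lt_neqAle eq_sym n0 rnorm_ge0.
have e0 : 0 < cnorm (f x) / 2 by rewrite divr_gt0.
have [g [K [[cK KU sg] cg g0 g1]]] := haar_bump ((cvg_rnorm (f : G -> R[i]^o) _).1 (cf x) _ e0).
have Cg : Cc R G (fun y => (g y)%:C) by apply/CcP; exists K.
have ig := Cc_cintegrable Cg.
have igf := Cc_cintegrable (CcMr Cg cf).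
have : intg (fun y => f x * (g y)%:C - (g y)%:C * f y) = f x.
  by rewrite cintegralB ?cintegralZ ?H ?cintegral_real ?g1 ?subr0 ?mulr1//; exact: cintegrableZ.
move=> E; have : cnorm (f x) <= cnorm (f x) / 2; last by lra.
rewrite -{1}E; have [igr _] := ig.
have -> : cnorm (f x) / 2 = cnorm (f x) / 2 * \int[mu]_y g y by rewrite g1 mulr1.
rewrite -RintegralZl//.
apply: cintegral_le; first by apply: cintegrableB => //; exact: cintegrableZ.
  exact: (integrableZl measurableT _ igr).
move=> y; rewrite [f x * _]mulrC -mulrBr rnormM rnorm_real ger0_norm// mulrC.
have [/KU/ltW ?|nK] := pselect (K y); first exact: ler_wpM2r.
by have /complexI -> := sg y nK; rewrite !mulr0.
Qed.

End haar.

(** * Reflection and convolution *)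

(* Keeps conversion tests from unfolding Lebesgue integrals. *)
#[local] Opaque cintegral.

Section algebra.
Context {R : realType} {G : lcGroupType}.
Variable mu : {measure set (borel G) -> \bar R}.
Hypothesis hmu : left_haar mu.
Implicit Types (f h phi : G -> R[i]) (K : set G).
Local Notation intg := (cintegral mu).
Local Notation cint := (@cintegrable R G mu).
Local Notation cts phi := (continuous (phi : G -> R[i]^o)).
Local Notation refl := (reflection mu).
Local Notation conv := (convolution mu).

Lemma continuousM_C (T : topologicalType) (u v : T -> R[i]^o) :
  continuous u -> continuous v -> continuous (fun t => u t * v t : R[i]^o).
Proof. by move=> cu cv t; apply: (@cvgM R[i] T); [exact: cu|exact: cv]. Qed.

Lemma continuous_comp_C (S T : topologicalType) (u : S -> T) (v : T -> R[i]^o) :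
  continuous u -> continuous v -> continuous (fun t => v (u t)).
Proof. by move=> cu cv t; apply: (@continuous_comp _ _ _ u v); [exact: cu|exact: cv]. Qed.

Lemma cintegralZr (a : R[i]) f : cint f -> intg (fun x => f x * a) = intg f * a.
Proof.
move=> cf; rewrite mulrC -cintegralZ//.
by congr (cintegral _ _); apply/funext => x; rewrite mulrC.
Qed.

Lemma CcMl f h : cts h -> Cc R G f -> Cc R G (fun x => h x * f x).
Proof.
move=> ch Cf; have := CcMr Cf ch.
by congr (Cc R G); apply/funext => x; rewrite mulrC.
Qed.

Lemma cont_fst (S T : topologicalType) : continuous (fun z : S * T => z.1).
Proof. by move=> z; exact: cvg_fst. Qed.

Lemma cont_snd (S T : topologicalType) : continuous (fun z : S * T => z.2).
Proof. by move=> z; exact: cvg_snd. Qed.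

Lemma cont_mull (y : G) : continuous (fun x : G => (y * x)%g).
Proof. by apply: continuous_mulg_fun => t; [exact: cvg_cst|exact: cvg_id]. Qed.

Lemma cont_invmul (x : G) : continuous (fun y : G => (y^-1 * x)%g).
Proof. by apply: continuous_mulg_fun => t; [exact: invg_continuous|exact: cvg_cst]. Qed.

Lemma cont_mulinv (x : G) : continuous (fun y : G => (x * y^-1)%g).
Proof. by apply: continuous_mulg_fun => t; [exact: cvg_cst|exact: invg_continuous]. Qed.

Lemma cont_mulr (y : G) : continuous (fun x : G => (x * y)%g).
Proof. by apply: continuous_mulg_fun => t; [exact: cvg_id|exact: cvg_cst]. Qed.

(* If [phi] has integral 1, inserting it as a factor and translating twice turns
   the integral of [h x^-1] into that of [h x * D x], with [D x] the integral of
   [phi (y * x)] over [y]. *)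
Lemma inversion_density : exists2 D : G -> R[i], cts D &
  forall h, Cc R G h -> intg (fun x => h x^-1%g) = intg (fun x => h x * D x).
Proof.
have [g [A [[cA _ sA] cg _ g1]]] := haar_bump hmu (filterT : nbhs (1%g : G) setT).
pose phi x := (g x)%:C : R[i]^o.
have Cphi : Cc R G phi by apply/CcP; exists A.
have iphi : cint phi := Cc_cintegrable hmu Cphi.
have phi1 : intg phi = 1 by rewrite cintegral_real g1.
pose D x := intg (fun y => phi (y * x)%g).
have cD : cts D.
  (* For [x] in [V], the condition that [y * x] lies in [A] forces [y] into the compact product of
     [A] with the inverses of [V]. *)
  move=> x0; have [V xV cV] := compact_nbhs x0.
  apply: (parametric_near hmu (k := fun x y => phi (y * x)%g)
    (B := [set (x.1 * x.2)%g | x in A `*` [set x^-1%g | x in V]])).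
  - apply: continuous_comp_C cg; apply: continuous_mulg_fun; [exact: cont_snd|exact: cont_fst].
  - by apply: compact_mulg => //; exact: compact_invg.
  - apply: filterS xV => x Vx y ny; apply: sA => Ayx; apply: ny.
    by exists ((y * x)%g, x^-1%g); [split=> //; exists x|rewrite /= mulgK].
exists D => // h Ch; have [B [ch cB sB]] := (CcP h).1 Ch.
pose AB := [set (x.1 * x.2)%g | x in A `*` [set x^-1%g | x in B]].
have cAB : compact AB by apply: compact_mulg => //; exact: compact_invg.
transitivity (intg (fun x => intg (fun y => phi x * h (y^-1 * x)%g))).
  transitivity (intg (fun x => phi x * intg (fun x => h x^-1%g))).
    by rewrite (cintegralZr _ iphi) phi1 mul1r.
  congr (cintegral _ _); apply/funext => x.
  have ih := Cc_cintegrable hmu (Cc_inv Ch).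
  rewrite -(cintegral_transl hmu x^-1%g ih) -cintegralZ.
    by congr (cintegral _ _); apply/funext => y; rewrite invgM invgK.
  apply: (Cc_cintegrable hmu); apply/CcP; exists [set (x * y^-1)%g | y in B]; split.
  - apply: (@continuous_comp_C _ _ _ (h : G -> R[i]^o)) => //.
    by apply: continuous_invg_fun; exact: cont_mull.
  - apply: continuous_compact => //; apply: continuous_subspaceT.
    by apply: continuous_mulg_fun => t; [exact: cvg_cst|exact: invg_continuous].
  - move=> y ny; apply: sB => By; apply: ny; exists (x^-1 * y)^-1%g => //.
    by rewrite invgK mulVKg.
transitivity (intg (fun x => intg (fun y => phi (y * x)%g * h x))); last first.
  congr (cintegral _ _); apply/funext => x; rewrite -cintegralZ.
    by congr (cintegral _ _); apply/funext => y; rewrite mulrC.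
  apply: (Cc_cintegrable hmu); apply/CcP.
  exists [set (y * x^-1)%g | y in A]; split.
  - by apply: continuous_comp_C cg; exact: cont_mulr.
  - apply: continuous_compact => //; apply: continuous_subspaceT; exact: cont_mulr.
  - by move=> y ny; apply: sA => Ay; apply: ny; exists (y * x)%g => //; rewrite mulgK.
pose k1 x y : R[i]^o := phi x * h (y^-1 * x)%g.
pose k2 x y : R[i]^o := phi (y * x)%g * h x.
have ck1 : continuous (fun z : G * G => k1 z.1 z.2).
  apply: continuousM_C; first exact: (continuous_comp_C (@cont_fst G G) cg).
  apply: continuous_comp_C ch.
  apply: continuous_mulg_fun; last exact: cont_fst.
  by apply: continuous_invg_fun; exact: cont_snd.
have ck2 : continuous (fun z : G * G => k2 z.1 z.2).
  apply: continuousM_C; last exact: (continuous_comp_C (@cont_fst G G) ch).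
  by apply: continuous_comp_C cg; apply: continuous_mulg_fun; [exact: cont_snd|exact: cont_fst].
have A1 x y : ~ A x -> k1 x y = 0 by move=> nA; rewrite /k1 /phi sA ?mul0r.
have B1 x y : ~ AB y -> k1 x y = 0.
  move=> nAB; rewrite /k1; have [Ax|/sA e] := pselect (A x); last by rewrite /phi e mul0r.
  rewrite sB ?mulr0// => Byx; apply: nAB.
  exists (x, (y^-1 * x)^-1%g); first by split=> //; exists (y^-1 * x)%g.
  by rewrite /= invgM invgK mulVKg.
have A2 x y : ~ B x -> k2 x y = 0 by move=> nB; rewrite /k2 sB ?mulr0.
have B2 x y : ~ AB y -> k2 x y = 0.
  move=> nAB; rewrite /k2; have [Bx|/sB ->] := pselect (B x); last by rewrite mulr0.
  rewrite /phi sA ?mul0r// => Ayx; apply: nAB.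
  by exists ((y * x)%g, x^-1%g); [split=> //; exists x|rewrite /= mulgK].
transitivity (intg (fun y => intg (k1^~ y))); first exact: (fubini hmu ck1 cA cAB A1 B1).
transitivity (intg (fun y => intg (k2^~ y))); last first.
  by apply/esym; exact: (fubini hmu ck2 cB cAB A2 B2).
congr (cintegral _ _); apply/funext => y.
have Ck2 : Cc R G (k2^~ y).
  exact: (CcMl (continuous_comp_C (@cont_mull y) cg) Ch).
rewrite -[RHS](cintegral_transl hmu y^-1%g (Cc_cintegrable hmu Ck2)).
by congr (cintegral _ _); apply/funext => x; rewrite /k1 /k2 mulVKg.
Qed.

(** The density formula applied to the function f (x^-1) phi x gives existence, and [Cc_separated]
    gives uniqueness. Test functions range over all continuous functions, since [f] already has
    compact support: the constant 1 and the coefficients of representations are used later. *)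
Lemma reflectionP f : Cc R G f -> Cc R G (refl f) /\
  forall phi, cts phi -> intg (fun x => phi x * refl f x) = intg (fun x => phi x^-1%g * f x).
Proof.
move=> Cf; have [D cD HD] := inversion_density.
pose f' x := f x^-1%g * D x.
have Cf' : Cc R G f' := CcMr (Cc_inv Cf) cD.
have Hf' phi : cts phi -> intg (fun x => phi x * f' x) = intg (fun x => phi x^-1%g * f x).
  move=> cphi; have Ch : Cc R G (fun x => f x^-1%g * phi x) := CcMr (Cc_inv Cf) cphi.
  transitivity (intg (fun x => f x^-1%g * phi x * D x)).
    by congr (cintegral _ _); apply/funext => x; rewrite /f'; ring.
  rewrite -HD//; congr (cintegral _ _); apply/funext => x.
  by rewrite invgK mulrC.
suff -> : refl f = f' by [].
rewrite /reflection; case: xgetP => [f2 _ [Cf2 Hf2]|/(_ f') []]; last first.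
  by split; [exact: Cf'|move=> h [ch _]; exact: Hf'].
apply/funext => x; apply/eqP; rewrite -subr_eq0; apply/eqP.
apply: (Cc_separated hmu (f := fun x => f2 x - f' x)) x => [|h Ch].
  exact: (CcB Cf2 Cf').1.
have -> : (fun x => h x * (f2 x - f' x)) = (fun x => h x * f2 x - h x * f' x).
  by apply/funext => x; rewrite mulrBr.
have i2 := Cc_cintegrable hmu (CcMl Ch.1 Cf2).
have i' := Cc_cintegrable hmu (CcMl Ch.1 Cf').
by rewrite (cintegralB i2 i') (Hf2 _ Ch) (Hf' _ Ch.1) subrr.
Qed.

Lemma Cc_eqP f h : Cc R G f -> Cc R G h ->
  (forall phi, Cc R G phi -> intg (fun x => phi x * f x) = intg (fun x => phi x * h x)) ->
  f = h.
Proof.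
move=> Cf Ch H; apply/funext => x; apply/eqP; rewrite -subr_eq0; apply/eqP.
apply: (Cc_separated hmu (f := fun x => f x - h x)) x => [|phi Cphi].
  exact: (CcB Cf Ch).1.
have -> : (fun x => phi x * (f x - h x)) = (fun x => phi x * f x - phi x * h x).
  by apply/funext => x; rewrite mulrBr.
have i1 := Cc_cintegrable hmu (CcMl Cphi.1 Cf).
have i2 := Cc_cintegrable hmu (CcMl Cphi.1 Ch).
by rewrite (cintegralB i1 i2) (H _ Cphi) subrr.
Qed.

Lemma reflectionK f : Cc R G f -> refl (refl f) = f.
Proof.
move=> Cf; have [C1 H1] := reflectionP Cf; have [C2 H2] := reflectionP C1.
apply: Cc_eqP => // phi [cphi _]; rewrite (H2 _ cphi).
rewrite (H1 _ (continuous_comp_C (@invg_continuous G) cphi)).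
by congr (cintegral _ _); apply/funext => x; rewrite invgK.
Qed.

Lemma cintegral_linearr (a : R[i]) f h phi : Cc R G f -> Cc R G h -> cts phi ->
  intg (fun x => phi x * (a * f x + h x)) =
  a * intg (fun x => phi x * f x) + intg (fun x => phi x * h x).
Proof.
move=> Cf Ch cphi; rewrite -cintegral_linear.
- by congr (cintegral _ _); apply/funext => x; ring.
- by apply: (Cc_cintegrable hmu); exact: CcMl.
- by apply: (Cc_cintegrable hmu); exact: CcMl.
Qed.

Lemma reflection_linear (a : R[i]) f h : Cc R G f -> Cc R G h ->
  refl (fun x => a * f x + h x) = (fun x => a * refl f x + refl h x).
Proof.
move=> Cf Ch; have [C1 H1] := reflectionP Cf; have [C2 H2] := reflectionP Ch.
have [C3 H3] := reflectionP (Cc_linear a Cf Ch).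
apply: Cc_eqP => //; first exact: Cc_linear.
move=> phi [cphi _]; have cphi' := continuous_comp_C (@invg_continuous G) cphi.
rewrite (H3 _ cphi) (cintegral_linearr a Cf Ch cphi').
by rewrite (cintegral_linearr a C1 C2 cphi) (H1 _ cphi) (H2 _ cphi).
Qed.

Lemma cintegral_reflection f : Cc R G f -> intg (refl f) = intg f.
Proof.
move=> Cf; have [_ /(_ (fun=> 1)) H] := reflectionP Cf.
have E k : (fun x => 1 * k x) = k :> (G -> R[i]) by apply/funext => x; rewrite mul1r.
by rewrite !E in H; apply: H => x; exact: cvg_cst.
Qed.

Section convolution.
Variables (f h : G -> R[i]).
Hypotheses (Cf : Cc R G f) (Ch : Cc R G h).

Lemma Cc_convolution : Cc R G (conv f h).
Proof.
have [A [cf cA sA]] := (CcP f).1 Cf; have [B [ch cB sB]] := (CcP h).1 Ch.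
apply/CcP; exists [set (x.1 * x.2)%g | x in A `*` B]; split.
- move=> x0; apply: (parametric_near hmu (k := fun x y => f y * h (y^-1 * x)%g) (B := A)) => //.
    apply: continuousM_C; first exact: (continuous_comp_C (@cont_snd G G) cf).
    apply: continuous_comp_C ch.
    apply: continuous_mulg_fun; last exact: cont_fst.
    by apply: continuous_invg_fun; exact: cont_snd.
  by apply: nearW => x y nA; rewrite sA ?mul0r.
- exact: compact_mulg.
- move=> x nAB; rewrite /convolution -(cintegral0 mu); congr (cintegral _ _).
  apply/funext => y; have [Ay|/sA ->] := pselect (A y); last by rewrite mul0r.
  rewrite sB ?mulr0// => Byx; apply: nAB.
  by exists (y, (y^-1 * x)%g); [|rewrite /= mulVKg].
Qed.

(** Weak form of convolution, by Fubini and a left translation by [y]. Keeping [phi] merely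
    continuous lets it be a coefficient of a representation. *)
Lemma cintegral_convolution phi : cts phi ->
  intg (fun x => phi x * conv f h x) =
  intg (fun y => f y * intg (fun x => phi (y * x)%g * h x)).
Proof.
move=> cphi; have [A [cf cA sA]] := (CcP f).1 Cf; have [B [ch cB sB]] := (CcP h).1 Ch.
pose AB := [set (x.1 * x.2)%g | x in A `*` B].
have cAB : compact AB by exact: compact_mulg.
pose k x y : R[i]^o := phi x * (f y * h (y^-1 * x)%g).
have ck : continuous (fun z : G * G => k z.1 z.2).
  apply: continuousM_C; first exact: (continuous_comp_C (@cont_fst G G) cphi).
  apply: continuousM_C; first exact: (continuous_comp_C (@cont_snd G G) cf).
  apply: continuous_comp_C ch.
  apply: continuous_mulg_fun; last exact: cont_fst.
  by apply: continuous_invg_fun; exact: cont_snd.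
have s2 x y : ~ A y -> k x y = 0 by move=> nA; rewrite /k sA // mul0r mulr0.
have s1 x y : ~ AB x -> k x y = 0.
  move=> nAB; have [Ay|/s2 -> //] := pselect (A y).
  rewrite /k (sB (y^-1 * x)%g) ?mulr0// => Byx; apply: nAB.
  by exists (y, (y^-1 * x)%g); [|rewrite /= mulVKg].
transitivity (intg (fun x => intg (k x))).
  congr (cintegral _ _); apply/funext => x; rewrite /convolution -cintegralZ; first by [].
  exact: (Cc_cintegrable hmu (CcMr Cf (continuous_comp_C (@cont_invmul x) ch))).
transitivity (intg (fun y => intg (k^~ y))); first exact: (fubini hmu ck cAB cA s1 s2).
congr (cintegral _ _); apply/funext => y.
have Cp : Cc R G (fun x => phi (y * x)%g * h x).
  exact: CcMl (continuous_comp_C (@cont_mull y) cphi) Ch.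
have ip := Cc_cintegrable hmu Cp.
rewrite -(cintegral_transl hmu y^-1%g ip) -cintegralZ.
  by congr (cintegral _ _); apply/funext => x; rewrite mulVKg /k; ring.
have Cp2 : Cc R G (fun x => phi (y * (y^-1 * x))%g * h (y^-1 * x)%g).
  apply/CcP; exists [set (y * x)%g | x in B]; split.
  - by apply: continuous_comp_C Cp.1; exact: cont_mull.
  - by apply: continuous_compact => //; apply: continuous_subspaceT; exact: cont_mull.
  - move=> x nx; rewrite (sB (y^-1 * x)%g) ?mulr0// => Bx; apply: nx.
    by exists (y^-1 * x)%g => //; rewrite mulVKg.
exact: (Cc_cintegrable hmu Cp2).
Qed.

End convolution.

(** Tested against [phi], both sides become the double integral of phi ((x y)^-1) f x h y. On the
    right, [refl f] is removed inside, which produces [psi], and then [refl h] against [psi]. The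
    order is reversed because inversion reverses products. *)
Lemma reflection_convolution f h : Cc R G f -> Cc R G h ->
  refl (conv f h) = conv (refl h) (refl f).
Proof.
move=> Cf Ch; have [Cf' Hf] := reflectionP Cf; have [Ch' Hh] := reflectionP Ch.
have Cfh := Cc_convolution Cf Ch; have [Cr Hr] := reflectionP Cfh.
apply: Cc_eqP => // [|phi [cphi _]]; first exact: Cc_convolution.
have cphi' := continuous_comp_C (@invg_continuous G) cphi.
have [A [cf cA sA]] := (CcP f).1 Cf; have [B [ch cB sB]] := (CcP h).1 Ch.
rewrite (Hr _ cphi) (cintegral_convolution Cf Ch cphi').
rewrite (cintegral_convolution Ch' Cf' cphi).
pose psi y := intg (fun x => phi (y * x^-1)%g * f x).
have cpsi : cts psi.
  move=> y0; apply: (parametric_near hmu (k := fun y x => phi (y * x^-1)%g * f x) (B := A)) => //.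
    apply: continuousM_C; last exact: (continuous_comp_C (@cont_snd G G) cf).
    apply: continuous_comp_C cphi; apply: continuous_mulg_fun; first exact: cont_fst.
    by apply: continuous_invg_fun; exact: cont_snd.
  by apply: nearW => y x nA; rewrite (sA x) ?mulr0.
transitivity (intg (fun y => psi y * refl h y)); last first.
  congr (cintegral _ _); apply/funext => y; rewrite mulrC; congr (_ * _).
  by rewrite (Hf _ (continuous_comp_C (@cont_mull y) cphi)).
rewrite (Hh _ cpsi).
pose k x y : R[i]^o := f x * (phi (x * y)^-1%g * h y).
have ck : continuous (fun z : G * G => k z.1 z.2).
  apply: continuousM_C; first exact: (continuous_comp_C (@cont_fst G G) cf).
  apply: continuousM_C; last exact: (continuous_comp_C (@cont_snd G G) ch).
  by apply: continuous_comp_C cphi; apply: continuous_invg_fun; exact: mulg_continuous.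
have s1 x y : ~ A x -> k x y = 0 by move=> nA; rewrite /k sA // mul0r.
have s2 x y : ~ B y -> k x y = 0 by move=> nB; rewrite /k (sB y) // !mulr0.
transitivity (intg (fun x => intg (k x))).
  congr (cintegral _ _); apply/funext => x; rewrite -cintegralZ; first by [].
  exact: (Cc_cintegrable hmu (CcMl (continuous_comp_C (@cont_mull x) cphi') Ch)).
transitivity (intg (fun y => intg (k^~ y))); first exact: (fubini hmu ck cA cB s1 s2).
congr (cintegral _ _); apply/funext => y; rewrite /psi -cintegralZr.
  by congr (cintegral _ _); apply/funext => x; rewrite /k invgM; ring.
exact: (Cc_cintegrable hmu (CcMl (continuous_comp_C (@cont_mulinv y^-1%g) cphi) Cf)).
Qed.

Lemma convolution_conj f h : Cc R G f -> Cc R G h ->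
  conv (fun x => conjc (f x)) (fun x => conjc (h x)) = fun x => conjc (conv f h x).
Proof.
move=> Cf Ch; apply/funext => x; rewrite /convolution -cintegral_conj.
  by congr (cintegral _ _); apply/funext => y; rewrite rmorphM.
exact: (Cc_cintegrable hmu (CcMr Cf (continuous_comp_C (@cont_invmul x) Ch.1))).
Qed.

End algebra.

(** * Integrated representations *)

Notation contractive xi := (forall x, rnorm (xi x : _[i]^o) <= rnorm x).

Section dual_facts.
Context {R : realType} {E : normedModType R[i]}.

Lemma dualD (xi : dual E) x y : xi (x + y) = xi x + xi y.
Proof. exact: (linD (dual_bl xi).1). Qed.
Lemma dualB (xi : dual E) x y : xi (x - y) = xi x - xi y.
Proof. exact: (linB (dual_bl xi).1). Qed.
Lemma dualZ (xi : dual E) a x : xi (a *: x) = a * xi x.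
Proof. exact: (linZ (dual_bl xi).1). Qed.

Lemma dual_sum (xi : dual E) (T : Type) (q : seq T) (u : T -> E) :
  xi (\sum_(t <- q) u t) = \sum_(t <- q) xi (u t).
Proof.
elim: q => [|t q IH]; first by rewrite !big_nil (lin0 (dual_bl xi).1).
by rewrite !big_cons dualD IH.
Qed.

(** Quadrature is uniform only over contractive functionals; homogeneity reaches the others. The
    [+ 1] in the scaling factor avoids division by a zero norm. *)
Lemma contractive_eq (y : E) (phi : dual E -> R[i]) :
  (forall (a : R[i]) xi, phi (a *: xi) = a * phi xi) ->
  (forall xi : dual E, contractive xi -> xi y = phi xi) ->
  forall xi : dual E, xi y = phi xi.
Proof.
move=> phiZ H xi; have c0 : 0 < op_norm xi + 1.
  by rewrite ltr_wpDl// op_norm_ge0//; exact: dual_bl.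
have cn0 : (op_norm xi + 1)%:C != 0 :> R[i] by rewrite fmorph_eq0 gt_eqF.
have /H/(congr1 (fun z => (op_norm xi + 1)%:C * z)) : contractive (((op_norm xi + 1)^-1)%:C *: xi).
  move=> x; rewrite rnormM rnorm_real gtr0_norm ?invr_gt0// mulrC ler_pdivrMr//.
  apply: le_trans (op_normP (dual_bl xi) x) _.
  by rewrite mulrC ler_wpM2l ?rnorm_ge0// lerDl.
by rewrite phiZ [X in X = _ -> _]mulrA mulrA fmorphV divff// !mul1r.
Qed.

End dual_facts.

Section dual_subspaces.
Context {R : realType}.

Lemma dual_fun_linear (V : normedModType R[i]) (a : R[i]) (u v : dual V) x :
  (a *: u + v) x = a *: (u x : R[i]^o) + v x.
Proof. by []. Qed.

Lemma subspace_val_linear (V : normedModType R[i]) (S : closed_subspace V)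
    (a : R[i]) (u v : subspace_of S) :
  subspace_val (a *: u + v) = a *: subspace_val u + subspace_val v.
Proof. by []. Qed.

Lemma subspace_eval_bounded (V : normedModType R[i]) (S : closed_subspace (dual V)) x :
  bounded_linear (fun u : subspace_of S => subspace_val u x : R[i]^o).
Proof.
apply: (@bound_bounded_linear _ _ _ _ (rnorm x)).
  by move=> a u v; rewrite subspace_val_linear dual_fun_linear.
by move=> u; rewrite mulrC; exact: (op_normP (dual_bl (subspace_val u))).
Qed.

End dual_subspaces.

Section reps.
Context {R : realType} {G : lcGroupType}.
Variable mu : {measure set (borel G) -> \bar R}.
Hypothesis hmu : left_haar mu.
Implicit Types (f h phi : G -> R[i]) (K : set G) (pi : representation R G).
Local Notation intg := (cintegral mu).
Local Notation cint := (@cintegrable R G mu).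
Local Notation vol := (vol mu).
Local Notation cts phi := (continuous (phi : G -> R[i]^o)).
Local Notation rint pi := (@rep_integral R G mu pi).
Local Notation conv := (convolution mu).

(** The quadrature sums of [Psi] approximate the integral uniformly over contractive functionals.
    Since these functionals recover the norm, the sums form a Cauchy sequence in [E], and its limit
    is the integral. *)
Lemma weak_integral (E : completeNormedModType R[i]) (Psi : G -> E) K :
  continuous Psi -> compact K -> (forall x, ~ K x -> Psi x = 0) ->
  exists y, forall xi : dual E, xi y = intg (fun x => xi (Psi x)).
Proof.
move=> cPsi cK sPsi.
have cxi (xi : dual E) : cts (fun x => xi (Psi x)).
  by move=> x; apply: (@continuous_comp _ _ _ Psi xi); [exact: cPsi|exact: (dual_bl xi).2].
have sxi (xi : dual E) : supported K (fun x => xi (Psi x)).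
  by move=> x /sPsi ->; exact: lin0 (dual_bl xi).1.
have ixi xi := continuous_cintegrable hmu (cxi xi) cK (sxi xi).
have v0 : 0 < vol K + 1 by rewrite ltr_wpDl// vol_ge0.
have app (e : R) : 0 < e -> exists y, forall xi : dual E, contractive xi ->
    cnorm (xi y - intg (fun x => xi (Psi x))) <= e.
  move=> e0; have d0 : 0 < e / (vol K + 1) by rewrite divr_gt0.
  pose Phi (i : {xi : dual E | contractive xi}) x := sval i (Psi x).
  have [q _ Hq] : exists2 q : seq (R * G), all (fun p => 0 <= p.1) q &
      forall i, cnorm (intg (Phi i) - \sum_(p <- q) p.1%:C * Phi i p.2) <= e / (vol K + 1) * vol K.
    apply: (quadrature hmu cK).
    - by move=> i; exact: ixi.
    - by move=> i; exact: sxi.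
    - move=> z; apply: filterS ((cvg_rnorm Psi _).1 (cPsi z) _ d0) => x Hx [xi cx] /=.
      by rewrite /Phi /= -dualB; apply: le_trans (cx _) _; rewrite rnormB ltW.
  exists (\sum_(p <- q) p.1%:C *: Psi p.2) => xi cx.
  have := Hq (exist _ xi cx); rewrite rnormB dual_sum /Phi /=.
  under eq_bigr do rewrite -dualZ; move=> /le_trans; apply.
  by rewrite mulrAC ler_pdivrMr// ler_pM2l// lerDl.
have /choice[y Hy] n := app n.+1%:R^-1 (ltac:(by rewrite invr_gt0)).
have cau n m : rnorm (y n - y m) <= n.+1%:R^-1 + m.+1%:R^-1.
  apply: rnorm_le_functionals => xi cx; rewrite dualB.
  rewrite -[xi (y n) - _](subrKA (intg (fun x => xi (Psi x)))).
  by apply: le_trans (rnormD _ _) _; apply: lerD; [|rewrite rnormB]; exact: Hy.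
have small (e : R) : 0 < e -> \forall n \near \oo, n.+1%:R^-1 < e :> R.
  by move=> e0; exact: near_infty_natSinv_lt (PosNum e0).
have /cauchy_cvg/cvg_ex[l yl] : cauchy (y @ \oo).
  apply/cauchy_rnorm => e e0; have e2 : 0 < e / 2 by rewrite divr_gt0.
  have [N _ HN] := small _ e2; exists (y N); exists N => // n Nn.
  apply: le_lt_trans (cau _ _) _; rewrite [e]splitr.
  by rewrite ltrD ?HN//=.
exists l; apply: contractive_eq => [a xi|xi cx].
  by rewrite -cintegralZ//; exact: ixi.
apply/eqP; rewrite -subr_eq0; apply/eqP; apply: (@rnorm0_eq0 _ R[i]^o); apply/eqP.
rewrite eq_le rnorm_ge0 andbT; apply/ler_addgt0Pr => e e0; rewrite add0r.
have e2 : 0 < e / 2 by rewrite divr_gt0.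
have [n [n2 yn]] : exists n : nat, n.+1%:R^-1 < e / 2 /\ rnorm (l - y n) < e / 2.
  by apply: (@filter_ex _ \oo); apply: filterI (small _ e2) ((cvg_rnorm _ _).1 yl _ e2).
rewrite -[xi l - _](subrKA (xi (y n))) [e]splitr; apply: le_trans (rnormD _ _) _.
apply: lerD; last by apply: le_trans (Hy n xi cx) _; exact: ltW.
by rewrite -dualB; apply: le_trans (cx _) _; exact: ltW.
Qed.

Lemma rep_coef_continuous pi (xi : dual (rep_space pi)) x : cts (fun g => xi (pi g x)).
Proof.
move=> g; apply: (@continuous_comp _ _ _ (fun g => pi g x) xi); last exact: (dual_bl xi).2.
exact: rep_continuous.
Qed.

Lemma rep_integralP pi f x (xi : dual (rep_space pi)) : Cc R G f ->
  xi (rint pi f x) = intg (fun g => f g * xi (pi g x)).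
Proof.
move=> /CcP[K [cf cK sf]]; rewrite /rep_integral.
set P := (X in get X); suff : P (get P) by exact.
apply: getPex.
have [|| y Hy] := @weak_integral (rep_space pi) (fun g => f g *: pi g x) K _ cK.
- move=> g; apply: (@cvgZ R[i]); first exact: cf.
  exact: rep_continuous.
- by move=> g /sf ->; rewrite scale0r.
exists y => eta; rewrite Hy; congr (cintegral _ _); apply/funext => g.
exact: dualZ.
Qed.

Lemma rep_integral_uniq pi f x y : Cc R G f ->
  (forall xi : dual (rep_space pi), xi y = intg (fun g => f g * xi (pi g x))) ->
  rint pi f x = y.
Proof. by move=> Cf H; apply: functionals_separate => xi; rewrite H rep_integralP. Qed.

Lemma coef_cintegrable pi f x (xi : dual (rep_space pi)) : Cc R G f ->
  cint (fun g => f g * xi (pi g x)).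
Proof. by move=> Cf; exact: (Cc_cintegrable hmu (CcMr Cf (@rep_coef_continuous pi xi x))). Qed.

Lemma rep_integral_linear pi f : Cc R G f -> linear (rint pi f).
Proof.
move=> Cf a x y; apply: rep_integral_uniq => // xi.
have i1 := coef_cintegrable x xi Cf; have i2 := coef_cintegrable y xi Cf.
rewrite dualD dualZ !rep_integralP// -(cintegral_linear a i1 i2).
congr (cintegral _ _); apply/funext => g.
by rewrite (rep_bounded pi g).1 dualD dualZ; ring.
Qed.

Lemma rep_integral_linear_fun pi (a : R[i]) f h x : Cc R G f -> Cc R G h ->
  rint pi (fun g => a * f g + h g) x =
  a *: rint pi f x + rint pi h x.
Proof.
move=> Cf Ch; apply: rep_integral_uniq => [|xi]; first exact: Cc_linear.
have i1 := coef_cintegrable x xi Cf; have i2 := coef_cintegrable x xi Ch.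
rewrite dualD dualZ !rep_integralP// -(cintegral_linear a i1 i2).
by congr (cintegral _ _); apply/funext => g; ring.
Qed.

Lemma rep_integralB pi f h x : Cc R G f -> Cc R G h ->
  rint pi (fun g => f g - h g) x = rint pi f x - rint pi h x.
Proof.
move=> Cf Ch.
have -> : (fun g => f g - h g) = (fun g => -1 * h g + f g).
  by apply/funext => g; rewrite mulN1r addrC.
by rewrite rep_integral_linear_fun// scaleN1r addrC.
Qed.

Lemma rep_integral_invariant pi f x : Cc R G f -> (forall g, pi g x = x) ->
  rint pi f x = intg f *: x.
Proof.
move=> Cf xI; apply: rep_integral_uniq => // xi; rewrite dualZ.
rewrite -cintegralZr; last exact: Cc_cintegrable.
by congr (cintegral _ _); apply/funext => g; rewrite xI.
Qed.

Lemma rep_integral_convolution pi f h x : Cc R G f -> Cc R G h ->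
  rint pi (conv f h) x = rint pi f (rint pi h x).
Proof.
move=> Cf Ch; apply: rep_integral_uniq => [|xi]; first exact: Cc_convolution.
rewrite rep_integralP//.
transitivity (intg (fun g => xi (pi g x) * conv f h g)); last first.
  by congr (cintegral _ _); apply/funext => g; rewrite mulrC.
rewrite (cintegral_convolution hmu Cf Ch (@rep_coef_continuous pi xi x)).
congr (cintegral _ _); apply/funext => g; congr (_ * _).
(* Transposing pi(g) turns the left side into a functional of pi(h)x, to which the characterization
   of the weak integral applies. *)
pose eta := transpose (rep_bounded pi g) xi.
rewrite -[LHS]/(eta (rint pi h x)) rep_integralP//.
by congr (cintegral _ _); apply/funext => k; rewrite repM mulrC.
Qed.

(** [C] depends on [f] and [K] but not on [pi], which makes the supremum over the class finite. *)
Lemma rep_integral_bound f K : Cc R G f -> compact K -> supported K f ->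
  exists2 C, 0 <= C & forall pi M, 0 <= M -> (forall g, K g -> op_norm (pi g) <= M) ->
    forall x, rnorm (rint pi f x) <= C * M * rnorm x.
Proof.
move=> Cf cK sf.
have [N N0 HN] : exists2 N : R, 0 <= N & forall g, K g -> cnorm (f g) <= N.
  have cn : continuous (fun g => cnorm (f g)).
    move=> g; apply/cvgrPdist_lt => e e0.
    apply: filterS ((cvg_rnorm _ _).1 (Cf.1 g) _ e0) => k.
    by apply: le_lt_trans; exact: rnorm_dist.
  have /compact_bounded[M [_ HM]] : compact ((fun g => cnorm (f g)) @` K).
    by apply: continuous_compact => //; exact: continuous_subspaceT.
  exists (`|M| + 1); first by rewrite addr_ge0.
  move=> g Kg; apply: le_trans (ler_norm _) _; apply: (HM (`|M| + 1)).
    by rewrite ltr_pwDr// ler_norm.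
  by exists g.
exists (N * vol K); first by rewrite mulr_ge0// vol_ge0.
move=> pi M M0 HM x; apply: rnorm_le_functionals => xi cx; rewrite rep_integralP//.
have -> : N * vol K * M * rnorm x = N * (M * rnorm x) * vol K by ring.
apply: (cintegral_bound hmu _ cK); first exact: coef_cintegrable.
  by move=> g nK; rewrite sf// mul0r.
move=> g Kg; rewrite rnormM; apply: ler_pM; rewrite ?rnorm_ge0 ?HN//.
apply: le_trans (cx _) _; apply: le_trans (op_normP (rep_bounded pi g) x) _.
by rewrite ler_wpM2r ?rnorm_ge0 ?HM.
Qed.

End reps.

(** * Norms over a class of representations and its dual class *)

Section classes.
Context {R : realType} {G : lcGroupType}.
Variable mu : {measure set (borel G) -> \bar R}.
Hypothesis hmu : left_haar mu.
Implicit Types (f phi : G -> R[i]) (K : set G) (pi : representation R G) (F : rep_class R G).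
Local Notation intg := (cintegral mu).
Local Notation cint := (@cintegrable R G mu).
Local Notation vol := (vol mu).
Local Notation cts phi := (continuous (phi : G -> R[i]^o)).
Local Notation refl := (reflection mu).
Local Notation rint pi := (@rep_integral R G mu pi).

Lemma rep_integral_bounded pi f : Cc R G f ->
  bounded_on_compacts (fun rho => rho = pi) -> bounded_linear (rint pi f).
Proof.
move=> Cf Hb; have [K [cf cK sf]] := (CcP f).1 Cf.
have [C C0 HC] := rep_integral_bound hmu Cf cK sf; have [M HM] := Hb K cK.
apply: (@bound_bounded_linear _ _ _ _ (C * `|M|)); first exact: rep_integral_linear.
by apply: HC => // g Kg; apply: le_trans (HM _ _ erefl Kg) _; exact: ler_norm.
Qed.

Lemma bounded_on_compacts1 F pi : bounded_on_compacts F -> F pi ->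
  bounded_on_compacts (fun rho => rho = pi).
Proof. by move=> HF Fpi K /HF[M HM]; exists M => _ g ->; exact: HM. Qed.

(** [0 <= B] covers the empty class, whose supremum is 0 by convention. *)
Lemma class_norm_le F f B : 0 <= B ->
  (forall pi, F pi -> op_norm (rint pi f) <= B) -> class_norm mu F f <= B.
Proof.
move=> B0 HB; rewrite /class_norm; set S := [set r | _].
have [->|/set0P S0] := eqVneq S set0; first by rewrite sup0.
by apply: ge_sup => // _ [pi Fpi ->]; exact: HB.
Qed.

Lemma class_norm_ub F f pi : bounded_on_compacts F -> Cc R G f -> F pi ->
  op_norm (rint pi f) <= class_norm mu F f.
Proof.
move=> HF Cf Fpi; apply: ub_le_sup; last by exists pi.
have [K [cf cK sf]] := (CcP f).1 Cf.
have [C C0 HC] := rep_integral_bound hmu Cf cK sf; have [M HM] := HF K cK.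
exists (C * `|M|) => _ [rho Frho ->]; apply: op_norm_le.
- exact: rep_integral_linear.
- by rewrite mulr_ge0.
- by apply: HC => // g Kg; apply: le_trans (HM _ _ Frho Kg) _; exact: ler_norm.
Qed.

Lemma class_norm_ge0 F f : bounded_on_compacts F -> Cc R G f -> 0 <= class_norm mu F f.
Proof.
move=> HF Cf; have [[pi Fpi]|nF] := pselect (exists pi, F pi).
  apply: le_trans (class_norm_ub HF Cf Fpi); apply: op_norm_ge0.
  exact: rep_integral_bounded Cf (bounded_on_compacts1 HF Fpi).
rewrite /class_norm (_ : [set r | _] = set0) ?sup0//.
by rewrite -subset0 => r [pi Fpi _]; apply: nF; exists pi.
Qed.

Lemma rep_integral_le F f pi x : bounded_on_compacts F -> Cc R G f -> F pi ->
  rnorm (rint pi f x) <= class_norm mu F f * rnorm x.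
Proof.
move=> HF Cf Fpi; apply: le_trans (op_normP _ x) _.
  exact: rep_integral_bounded Cf (bounded_on_compacts1 HF Fpi).
by rewrite ler_wpM2r ?rnorm_ge0//; exact: class_norm_ub.
Qed.

Lemma dual_class_bounded F : bounded_on_compacts F -> bounded_on_compacts (dual_class F).
Proof.
move=> HF K cK; have [M HM] := HF _ (compact_invg cK).
exists `|M| => _ g [pi Fpi ->] Kg; apply: op_norm_le => //.
  exact: (rep_bounded (dual_rep pi) g).1.
move=> xi; apply: (transpose_bound (rep_bounded pi g^-1%g) (M := `|M|)) => // x.
apply: le_trans (op_normP (rep_bounded pi _) x) _; rewrite ler_wpM2r ?rnorm_ge0//.
by apply: le_trans (ler_norm M); apply: HM => //; exists g.
Qed.

(* [xi] averaged against a bump function near 1 lies in the dual representation,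
   so the latter norms [rep_space pi] up to the constant [M]. *)
Lemma dual_subspace_norming pi (V : set G) M (y : rep_space pi) (xi : dual (rep_space pi)) (e : R) :
  bounded_on_compacts (fun rho => rho = pi) -> nbhs (1%g : G) V -> 0 <= M ->
  (forall g, V g -> op_norm (pi g^-1%g) <= M) -> contractive xi -> 0 < e ->
  exists eta : subspace_of (dual_subspace pi),
    rnorm eta <= M /\ cnorm (xi y - subspace_val eta y) <= e.
Proof.
move=> Hb V1 M0 HM cxi e0.
have ci : continuous (fun g : G => pi g^-1%g y).
  move=> g; apply: (@continuous_comp _ _ _ (fun x : G => x^-1%g) (fun g => pi g y)).
    exact: invg_continuous.
  exact: rep_continuous.
(* On this set pi(g^-1) has norm at most [M], which will bound the averaged functional, and moves
   [y] by less than [e], which will bound the change of its value at [y]. *)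
have U1 : nbhs (1%g : G) (V `&` [set g | rnorm (pi 1^-1%g y - pi g^-1%g y) < e]).
  exact: (filterI V1 ((cvg_rnorm (fun g : G => pi g^-1%g y) _).1 (ci 1%g) _ e0)).
have [g [K [[cK KU sg] cg g0 g1]]] := haar_bump hmu U1.
pose gc x := (g x)%:C : R[i]^o.
have Cg : Cc R G gc by apply/CcP; exists K.
have cinv x (zeta : dual (rep_space pi)) : cts (fun h => zeta (pi h^-1%g x)).
  exact: (continuous_comp_C (@invg_continuous G) (@rep_coef_continuous R G pi zeta x)).
pose eta0 x : R[i]^o := intg (fun h => gc h * xi (pi h^-1%g x)).
have ii x := Cc_cintegrable hmu (CcMr Cg (@cinv x xi)).
have leta : linear eta0.
  move=> a x z; rewrite /eta0 -[RHS](cintegral_linear a (ii x) (ii z)).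
  congr (cintegral _ _); apply/funext => h.
  by rewrite (rep_bounded pi h^-1%g).1 dualD dualZ; ring.
have [ig _] := Cc_cintegrable hmu Cg.
have avg B (k : G -> R[i]) : cts k -> (forall h, K h -> cnorm (k h) <= B) ->
    cnorm (intg (fun h => gc h * k h)) <= B.
  move=> ck HB; rewrite -[leRHS]mulr1 -[X in _ * X]g1 -RintegralZl//.
  apply: cintegral_le; first exact: (Cc_cintegrable hmu (CcMr Cg ck)).
    exact: (integrableZl measurableT _ ig).
  move=> h; rewrite rnormM rnorm_real ger0_norm// mulrC.
  have [Kh|nK] := pselect (K h); first by rewrite ler_wpM2r ?HB.
  by have /complexI -> := sg h nK; rewrite !mulr0.
have beta x : rnorm (eta0 x) <= M * rnorm x.
  apply: avg; first exact: cinv.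
  move=> h Kh; apply: le_trans (cxi _) _.
  apply: le_trans (op_normP (rep_bounded pi _) x) _.
  by rewrite ler_wpM2r ?rnorm_ge0// HM//; have [] := KU _ Kh.
have etaP : (eta0 : rep_space pi -> R[i]^o) \in functionals (rep_space pi).
  by rewrite inE; exact: bound_bounded_linear beta.
pose eta1 : dual (rep_space pi) := Dual etaP.
(* A translation moves [a] from the functional to the bump. Norm continuity of the orbit is thereby
   reduced to the uniform continuity of gc (a^-1 h) in [h], supplied by [tube]. *)
have orbit a x : contragredient a eta1 x = intg (fun h => gc (a^-1 * h)%g * xi (pi h^-1%g x)).
  have Ca : Cc R G (fun h => gc (a^-1 * h)%g * xi (pi h^-1%g x)).
    apply: CcMr; last exact: cinv.
    apply/CcP; exists [set (a * h)%g | h in K]; split.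
    - by apply: continuous_comp_C cg; exact: cont_mull.
    - by apply: continuous_compact => //; apply: continuous_subspaceT; exact: cont_mull.
    - move=> h nh; apply: sg => Kh; apply: nh.
      by exists (a^-1 * h)%g => //; rewrite mulVKg.
  rewrite -(cintegral_transl hmu a (Cc_cintegrable hmu Ca)).
  congr (cintegral _ _); apply/funext => h.
  by rewrite mulKg invgM repM.
have ceta : eta1 \in closed_subspace_pred (dual_subspace pi).
  apply: mem_set => a0; apply: (cvg_rnorm (fun a => contragredient a eta1) _).2 => d d0.
  have [V0 V0a cV0] := compact_nbhs a0.
  pose B := [set (x.1 * x.2)%g | x in V0 `*` K].
  have cB : compact B by exact: compact_mulg.
  have [N' HN'] := Hb _ (compact_invg cB); pose N := `|N'|.
  (* [N * vol B] is what integration over [B] against a unit vector costs; the [+ 1] keeps [D]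
     positive. Aiming at [d / 2] leaves room for a strict inequality. *)
  pose D := N * vol B + 1.
  have D0 : 0 < D by rewrite ltr_wpDl//; apply: mulr_ge0; [exact: normr_ge0|exact: vol_ge0].
  have dD : 0 < d / 2 / D by rewrite !divr_gt0.
  pose k (a h : G) : R[i]^o := gc (a^-1 * h)%g.
  have ck : continuous (fun z : G * G => k z.1 z.2).
    apply: continuous_comp_C cg; apply: continuous_mulg_fun; last exact: cont_snd.
    by apply: continuous_invg_fun; exact: cont_fst.
  have sk : \forall a \near a0, forall h, ~ B h -> k a h = 0.
    apply: filterS V0a => a V0a' h nB; apply: sg => Kh; apply: nB.
    by exists (a, a^-1 * h)%g => //=; rewrite mulVKg.
  have sk0 := nbhs_singleton sk.
  apply: filterS2 (tube ck cB sk dD) sk => a ka sa.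
  have d2 : 0 <= d / 2 by rewrite divr_ge0// ltW.
  suff : rnorm (contragredient a0 eta1 - contragredient a eta1) <= d / 2.
    by move=> /le_lt_trans; apply; rewrite ltr_pdivrMr//; lra.
  rewrite dual_rnorm; apply: op_norm_le => // [|x]; first exact: (dual_bl _).1.
  rewrite -[X in cnorm X]/(contragredient a0 eta1 x - contragredient a eta1 x) !orbit.
  have ik b : (forall h, ~ B h -> k b h = 0) -> cint (fun h => gc (b^-1 * h)%g * xi (pi h^-1%g x)).
    move=> sb; apply: (Cc_cintegrable hmu); apply: CcMr; last exact: cinv.
    apply/CcP; exists B; split; [|exact: cB|exact: sb].
    by apply: continuous_comp_C cg; exact: cont_mull.
  rewrite -(cintegralB (ik a0 sk0) (ik a sa)).
  apply: (@le_trans _ _ (d / 2 / D * (N * rnorm x) * vol B)).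
    apply: (cintegral_bound hmu _ cB); first exact: (cintegrableB (ik a0 sk0) (ik a sa)).
      by move=> h nB; have := sa h nB; have := sk0 h nB; rewrite /k => -> ->; rewrite mul0r subrr.
    move=> h Bh; rewrite -mulrBl rnormM; apply: ler_pM; rewrite ?rnorm_ge0//.
      by rewrite rnormB; exact: ka.
    apply: le_trans (cxi _) _; apply: le_trans (op_normP (rep_bounded pi _) x) _.
    rewrite ler_wpM2r ?rnorm_ge0//; apply: le_trans (ler_norm N').
    by apply: HN' => //; exists h.
  have -> : d / 2 / D * (N * rnorm x) * vol B = (d / 2 * rnorm x) * ((N * vol B) / D) by ring.
  rewrite -[leRHS]mulr1; apply: ler_wpM2l; first by apply: mulr_ge0 => //; exact: rnorm_ge0.
  by rewrite ler_pdivrMr// mul1r lerDl.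
exists (SubspaceOf ceta); split.
  by apply: op_norm_le.
have -> : xi y - subspace_val (SubspaceOf ceta) y =
    intg (fun h => gc h * (xi y - xi (pi h^-1%g y))).
  have E : xi y = xi y * intg gc by rewrite cintegral_real g1 mulr1.
  rewrite [X in X - _]E /= /eta0.
  rewrite -(cintegralZ (xi y) (Cc_cintegrable hmu Cg)).
  rewrite -(cintegralB (cintegrableZ _ (Cc_cintegrable hmu Cg)) (ii y)).
  by congr (cintegral _ _); apply/funext => h; rewrite /gc; ring.
apply: avg.
  by move=> h; apply: (@cvgB _ (R[i]^o)); [exact: cvg_cst|exact: cinv].
move=> h /KU[_ /ltW]; rewrite invg1 rep1 => H.
by rewrite -dualB; apply: le_trans (cxi _) _.
Qed.

(** For [eta] in the dual space, the value of [eta] at pi(f~)x is the value at [x] of the dual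
    operator of [f] applied to [eta]. Such [eta] norm [rep_space pi] up to [M], a bound for pi(g^-1)
    over a compact neighbourhood of 1, common to all [pi] in the class. *)
Lemma class_norm_reflection F : bounded_on_compacts F ->
  exists2 M, 0 <= M & forall f, Cc R G f ->
    class_norm mu F (refl f) <= M * class_norm mu (dual_class F) f.
Proof.
move=> HF; have [V V1 cV] := compact_nbhs (1%g : G).
have [M' HM'] := HF _ (compact_invg cV); pose M := `|M'|.
have M0 : 0 <= M := normr_ge0 M'.
exists M => // f Cf; have [Cf' Hf'] := reflectionP hmu Cf.
have HF' := dual_class_bounded HF; have n0 := class_norm_ge0 HF' Cf.
apply: class_norm_le => [|pi Fpi]; first by rewrite mulr_ge0.
apply: op_norm_le => [||x]; first exact: rep_integral_linear.
  by rewrite mulr_ge0.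
apply: rnorm_le_functionals => xi cxi; apply/ler_addgt0Pr => e e0.
have HM g : V g -> op_norm (pi g^-1%g) <= M.
  by move=> Vg; apply: le_trans (ler_norm M'); apply: HM' => //; exists g.
have [eta [eM ye]] := dual_subspace_norming (rint pi (refl f) x)
  (bounded_on_compacts1 HF Fpi) V1 (normr_ge0 M') HM cxi e0.
rewrite -[xi _](subrK (subspace_val eta (rint pi (refl f) x))) addrC.
apply: le_trans (rnormD _ _) _; apply: lerD => //.
rewrite rep_integralP//.
have -> : intg (fun g => refl f g * subspace_val eta (pi g x)) =
    subspace_val (rint (dual_rep pi) f eta) x.
  transitivity (intg (fun g => subspace_val eta (pi g x) * refl f g)).
    by congr (cintegral _ _); apply/funext => g; rewrite mulrC.
  rewrite (Hf' _ (@rep_coef_continuous R G pi (subspace_val eta) x)).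
  (* Evaluation at [x] is a continuous functional on the dual space, so the weak integral defining
     the dual operator can be read at [x]. *)
  pose ev (zeta : subspace_of (dual_subspace pi)) : R[i]^o := subspace_val zeta x.
  have evP : (ev : _ -> R[i]^o) \in functionals (subspace_of (dual_subspace pi)).
    by rewrite inE; exact: subspace_eval_bounded.
  have := @rep_integralP _ _ _ hmu (dual_rep pi) f eta (Dual evP) Cf.
  rewrite [X in X = _]/= /ev => ->.
  by congr (cintegral _ _); apply/funext => g; rewrite mulrC.
apply: le_trans (op_normP (dual_bl _) x) _.
rewrite -dual_rnorm; apply: ler_wpM2r; first exact: rnorm_ge0.
rewrite -[X in X <= _]/(rnorm (rint (dual_rep pi) f eta)).
have Fd : dual_class F (dual_rep pi) by exists pi.
apply: le_trans (rep_integral_le _ HF' Cf Fd) _.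
by rewrite mulrC ler_wpM2r.
Qed.

End classes.

(** * The completed algebra and its Kazhdan projections *)

Lemma rnorm_continuous (R : realType) (V : normedModType R[i]) : continuous (@rnorm R V).
Proof.
move=> x; apply/cvgrPdist_lt => e e0.
apply: filterS ((@cvg_rnorm _ V _ _ (nbhs_filter x) id x).1 (fun=> id) _ e0) => y.
exact: le_lt_trans (rnorm_dist x y).
Qed.

Lemma closure_ler (R : realType) (T : topologicalType) (S : set T) (u v : T -> R) p :
  continuous u -> continuous v -> (forall s, S s -> u s <= v s) ->
  closure S p -> u p <= v p.
Proof.
move=> cu cv uv Sp; rewrite -subr_le0.
have clC : closed [set t | u t - v t <= 0].
  apply: (@closed_comp _ _ (fun t => u t - v t) [set z | z <= 0]); last exact: closed_le.
  by move=> t _; apply: cvgB; [exact: cu|exact: cv].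
by apply: clC; apply: closure_subset Sp => s Ss /=; rewrite subr_le0 uv.
Qed.

Section completion.
Context {R : realType} {G : lcGroupType}.
Variable mu : {measure set (borel G) -> \bar R}.
Variables (F : rep_class R G) (A : completeNormedModType R[i]) (iota : (G -> R[i]) -> A).
Hypotheses (hmu : left_haar mu) (HF : bounded_on_compacts F) (HA : is_completion mu F iota).
Implicit Types (f h k : G -> R[i]) (pi : representation R G) (a b p : A).
Local Notation rint pi := (@rep_integral R G mu pi).
Local Notation conv := (convolution mu).
Local Notation cn := (class_norm mu F).

Lemma rnorm_iota f : Cc R G f -> rnorm (iota f) = cn f.
Proof. by move=> Cf; rewrite /rnorm (completion_norm HA). Qed.

Lemma iotaB f h : Cc R G f -> Cc R G h -> iota (fun x => f x - h x) = iota f - iota h.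
Proof.
move=> Cf Ch; have -> : (fun x => f x - h x) = (fun x => -1 * h x + f x).
  by apply/funext => x; rewrite mulN1r addrC.
by rewrite (completion_linear HA)// scaleN1r addrC.
Qed.

Lemma iotaZ (c : R[i]) f : Cc R G f -> iota (fun x => c * f x) = c *: iota f.
Proof.
move=> Cf; have z0 : iota (fun=> 0) = 0.
  have E : (fun=> 0) = (fun x => 0 - 0) :> (G -> R[i]) by apply/funext => x; rewrite subrr.
  have C0 := @Cc0 R G.
  by rewrite E (@iotaB (fun=> 0) (fun=> 0) C0 C0) subrr.
rewrite -[RHS]addr0 -z0 -(completion_linear HA)//; last exact: Cc0.
by congr iota; apply/funext => x; rewrite addr0.
Qed.

Lemma iota_dense a : closure [set iota f | f in Cc R G] a.
Proof.
move=> U aU; have [z [[Uz _] Sz]] : (interior U `&` [set: A]) `&` [set iota f | f in Cc R G] !=set0.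
  rewrite setIT; apply: (completion_dense HA); last exact: open_interior.
  by exists a.
by exists z; split=> //; exact: interior_subset.
Qed.

Lemma iota_dist f h B : Cc R G f -> Cc R G h -> 0 <= B ->
  (forall pi, F pi -> forall x, rnorm (rint pi f x - rint pi h x) <= B * rnorm x) ->
  rnorm (iota f - iota h) <= B.
Proof.
move=> Cf Ch B0 HB; rewrite -iotaB// rnorm_iota; last exact: CcB.
apply: class_norm_le => // pi Fpi; apply: op_norm_le => // [|x].
  by apply: rep_integral_linear => //; exact: CcB.
by rewrite rep_integralB//; exact: HB.
Qed.

Lemma rep_integral_iota f h pi x : Cc R G f -> Cc R G h -> F pi ->
  rnorm (rint pi f x - rint pi h x) <= rnorm (iota f - iota h) * rnorm x.
Proof.
move=> Cf Ch Fpi; have CB := CcB Cf Ch; rewrite -iotaB// rnorm_iota//.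
by rewrite -rep_integralB//; exact: rep_integral_le.
Qed.

Lemma rep_integral_iota1 f pi x : Cc R G f -> F pi ->
  rnorm (rint pi f x) <= rnorm (iota f) * rnorm x.
Proof. by move=> Cf Fpi; rewrite rnorm_iota//; exact: rep_integral_le. Qed.

(** The later argument meets pi(p) only through this estimate. It also justifies the choice made by
    [get]: an extension exists because [pi] belongs to the class, and density makes it unique. *)
Lemma completion_rep_lipschitz pi x f p : F pi -> Cc R G f ->
  rnorm (rint pi f x - @completion_rep R G mu A iota pi p x) <= rnorm (iota f - p) * rnorm x.
Proof.
move=> Fpi Cf.
have [|U lU HU] := @dense_extension R (G -> R[i]) (Cc R G) A (rep_space pi) iota
  (fun f => rint pi f x) (rnorm x) iota_dense.
  by move=> k h Ck Ch; rewrite mulrC; exact: rep_integral_iota.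
have cU := lipschitz_continuous lU.
have -> : @completion_rep R G mu A iota pi p x = U p; last first.
  by have := lU (iota f) p; rewrite ger0_norm ?rnorm_ge0// HU// mulrC.
rewrite /completion_rep; set P := (X in get X).
have [cT HT] : P (get P).
  by apply: getPex; exists U.
apply: (closure_eq cT cU _ (@iota_dense p)) => _ [k Ck <-].
by rewrite HT// HU.
Qed.

Lemma convolution_norm_l f h h' : Cc R G f -> Cc R G h -> Cc R G h' ->
  rnorm (iota (conv f h) - iota (conv f h')) <= rnorm (iota f) * rnorm (iota h - iota h').
Proof.
move=> Cf Ch Ch'; apply: iota_dist; [exact: Cc_convolution..| |].
  by rewrite mulr_ge0 ?rnorm_ge0.
move=> pi Fpi x; rewrite !rep_integral_convolution//.
rewrite -(linB (rep_integral_linear hmu Cf)) -mulrA.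
apply: le_trans (rep_integral_iota1 _ Cf Fpi) _.
by rewrite ler_wpM2l ?rnorm_ge0//; exact: rep_integral_iota.
Qed.

Lemma convolution_norm_r f f' h : Cc R G f -> Cc R G f' -> Cc R G h ->
  rnorm (iota (conv f h) - iota (conv f' h)) <= rnorm (iota h) * rnorm (iota f - iota f').
Proof.
move=> Cf Cf' Ch; apply: iota_dist; [exact: Cc_convolution..| |].
  by rewrite mulr_ge0 ?rnorm_ge0.
move=> pi Fpi x; rewrite !rep_integral_convolution//.
apply: le_trans (rep_integral_iota _ Cf Cf' Fpi) _.
rewrite [leRHS]mulrAC [leRHS]mulrC ler_wpM2l ?rnorm_ge0//.
exact: rep_integral_iota1.
Qed.

(** The product is extended one variable at a time: [L f] extends convolution by [f] to the second
    factor, then [M b] extends [L f b] in [f]. Each map has the norm of the fixed factor as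
    Lipschitz constant, which yields joint continuity. *)
Lemma completion_mulP : continuous (fun ab : A * A => completion_mul mu iota ab.1 ab.2) /\
  forall f h, Cc R G f -> Cc R G h ->
    completion_mul mu iota (iota f) (iota h) = iota (conv f h).
Proof.
rewrite /completion_mul; set P := (X in get X); suff : P (get P) by [].
apply: getPex.
(* [choice] asks for a total family, so membership in Cc sits under the existential and [id] serves
   elsewhere. *)
have /choice[L HL] f : exists U : A -> A, Cc R G f ->
    (forall a b, rnorm (U a - U b) <= rnorm (iota f) * rnorm (a - b)) /\
    (forall h, Cc R G h -> U (iota h) = iota (conv f h)).
  have [Cf|nCf] := pselect (Cc R G f); last by exists id.
  have [|U lU HU] := @dense_extension R _ (Cc R G) A A iota
    (fun h => iota (conv f h)) (rnorm (iota f)) iota_dense.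
    by move=> h h' Ch Ch'; exact: convolution_norm_l.
  by exists U => _; split=> // a b; rewrite -[X in X * _]ger0_norm ?rnorm_ge0.
have cL f : Cc R G f -> continuous (L f).
  by move=> Cf; exact: lipschitz_continuous (HL f Cf).1.
have subc (V : normedModType R[i]) (T : topologicalType) (u v : T -> V) :
    continuous u -> continuous v -> continuous (fun t => rnorm (u t - v t)).
  move=> cu cv t; apply: (@continuous_comp _ _ _ (fun t => u t - v t) (@rnorm R V)).
    by apply: cvgB; [exact: cu|exact: cv].
  exact: rnorm_continuous.
have lL f f' b : Cc R G f -> Cc R G f' ->
    rnorm (L f b - L f' b) <= rnorm b * rnorm (iota f - iota f').
  move=> Cf Cf'.
  apply: (closure_ler (S := [set iota h | h in Cc R G]) (u := fun b => rnorm (L f b - L f' b))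
    (v := fun b => rnorm b * rnorm (iota f - iota f')) _ _ _ (@iota_dense b)).
  - by apply: subc; exact: cL.
  - by move=> t; apply: cvgM; [exact: rnorm_continuous|exact: cvg_cst].
  - by move=> _ [h Ch <-]; rewrite (HL f Cf).2// (HL f' Cf').2//; exact: convolution_norm_r.
have /choice[M HM] b : exists U : A -> A,
    (forall a a', rnorm (U a - U a') <= rnorm b * rnorm (a - a')) /\
    (forall f, Cc R G f -> U (iota f) = L f b).
  have [|U lU HU] := @dense_extension R _ (Cc R G) A A iota (fun f => L f b) (rnorm b) iota_dense.
    by move=> f f' Cf Cf'; exact: lL.
  by exists U; split=> // a a'; rewrite -[X in X * _]ger0_norm ?rnorm_ge0.
have lM a b b' : rnorm (M b a - M b' a) <= rnorm a * rnorm (b - b').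
  apply: (closure_ler (S := [set iota h | h in Cc R G]) (u := fun a => rnorm (M b a - M b' a))
    (v := fun a => rnorm a * rnorm (b - b')) _ _ _ (@iota_dense a)).
  - by apply: subc; [exact: lipschitz_continuous (HM b).1|exact: lipschitz_continuous (HM b').1].
  - by move=> t; apply: cvgM; [exact: rnorm_continuous|exact: cvg_cst].
  - by move=> _ [h Ch <-]; rewrite (HM b).2// (HM b').2//; exact: (HL h Ch).1.
exists (fun a b => M b a); split=> [[a b]|f h Cf Ch]; last first.
  by rewrite (HM _).2// (HL f Cf).2.
apply: (cvg_rnorm (fun ab : A * A => M ab.2 ab.1) _).2 => e e0.
(* The change of the product is at most |a| |b - b'| + |b'| |a - a'|; since [d] is at most 1, |b'|
   is below |b| + 1. *)
pose D := rnorm a + rnorm b + 1.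
have D0 : 0 < D by rewrite ltr_wpDl ?addr_ge0 ?rnorm_ge0.
pose d := Num.min 1 (e / D).
have d0 : 0 < d by rewrite lt_min ltr01 divr_gt0.
apply: filterS2 ((cvg_rnorm (fun ab : A * A => ab.1) a).1 (@cvg_fst _ _ _ _ _) _ d0)
  ((cvg_rnorm (fun ab : A * A => ab.2) b).1 (@cvg_snd _ _ _ _ _) _ d0) => -[a' b'] /= aa bb.
have H1 := lM a b b'; have H2 := (HM b').1 a a'.
have H3 : rnorm b' <= rnorm b + rnorm (b - b').
  by rewrite -{1}[b'](subKr b) -[rnorm (b - b')]rnormN rnormD.
have H4 : rnorm (M b a - M b' a') <= rnorm (M b a - M b' a) + rnorm (M b' a - M b' a').
  by rewrite -[M b a - _](subrKA (M b' a)) rnormD.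
have [b1 be] : rnorm (b - b') < 1 /\ rnorm (b - b') < e / D.
  by move: bb; rewrite lt_min => /andP[].
have ae : rnorm (a - a') < e / D by move: aa; rewrite lt_min => /andP[].
apply: le_lt_trans H4 _; apply: (@lt_le_trans _ _ (D * (e / D))); last first.
  by rewrite mulrC divfK// gt_eqF.
move: (rnorm_ge0 a) (rnorm_ge0 b) (rnorm_ge0 b') (rnorm_ge0 (a - a')) (rnorm_ge0 (b - b')).
move: H1 H2 H3 ae be b1 D0.
rewrite /D; move: (rnorm a) (rnorm b) (rnorm b') (rnorm (a - a')) (rnorm (b - b'))
  (rnorm (M b a - M b' a)) (rnorm (M b' a - M b' a')) (e / _).
by move=> x1 x2 x3 x4 x5 x6 x7 x8 *; nra.
Qed.

End completion.

(** * Absorption, and invariance of Kazhdan projections under reflection and conjugation *)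

Section kazhdan.
Context {R : realType} {G : lcGroupType}.
Variable mu : {measure set (borel G) -> \bar R}.
Variables (F : rep_class R G) (A : completeNormedModType R[i]) (iota : (G -> R[i]) -> A).
Hypotheses (hmu : left_haar mu) (HF : bounded_on_compacts F) (HA : is_completion mu F iota).
Implicit Types (f h k : G -> R[i]) (pi : representation R G) (a b p q : A).
Local Notation intg := (cintegral mu).
Local Notation refl := (reflection mu).
Local Notation rint pi := (@rep_integral R G mu pi).
Local Notation conv := (convolution mu).
Local Notation m := (completion_mul mu iota).
Local Notation mean1 := [set iota f | f in [set f | Cc R G f /\ intg f = 1]].

Let iotaD a : closure [set iota f | f in Cc R G] a.
Proof. exact: (@iota_dense R G mu F A iota HA a). Qed.

Let mE f h : Cc R G f -> Cc R G h -> m (iota f) (iota h) = iota (conv f h).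
Proof. exact: (completion_mulP hmu HF HA).2. Qed.

Lemma completion_mul_continuous (T : topologicalType) (u v : T -> A) :
  continuous u -> continuous v -> continuous (fun t => m (u t) (v t)).
Proof.
exact: (continuous_pair_comp (k := fun ab : A * A => m ab.1 ab.2) (completion_mulP hmu HF HA).1).
Qed.

Let mul_continuousr a : continuous (fun b => m a b).
Proof.
by apply: (@completion_mul_continuous A (fun=> a) id) => t; [exact: cvg_cst|exact: cvg_id].
Qed.

(** For [h] in Cc and each [pi] in the class, pi(h)x is compared with the invariant vector z =
    pi(p)x, on which pi(f) acts as the integral of [f]. Hence f h - 1(f) h has norm at most [C]
    times the distance from [h] to [p], uniformly over the class, and [h] can tend to [p]. *)
Lemma kazhdan_projection_absorbs p f : kazhdan_projection mu iota F p -> Cc R G f ->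
  m (iota f) p = intg f *: p.
Proof.
move=> [_ _ Hp] Cf; apply/eqP; rewrite -subr_eq0; apply/eqP/rnorm0_eq0/eqP.
rewrite eq_le rnorm_ge0 andbT.
pose C := rnorm (iota f) + cnorm (intg f).
have C0 : 0 <= C by rewrite addr_ge0 ?rnorm_ge0.
(* The goal becomes the value at b = p of an inequality between continuous functions of [b], to be
   checked on Cc only. *)
have -> : 0 = C * rnorm (p - p) by rewrite subrr rnorm0 mulr0.
apply: (closure_ler (S := [set iota h | h in Cc R G])
  (u := fun b => rnorm (m (iota f) b - intg f *: b)) (v := fun b => C * rnorm (b - p))
  _ _ _ (@iotaD p)).
- move=> t; apply: (@continuous_comp _ _ _ (fun b => m (iota f) b - intg f *: b) (@rnorm R A)).
    apply: cvgB; last by apply: cvgZ; [exact: cvg_cst|exact: cvg_id].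
    exact: mul_continuousr.
  exact: rnorm_continuous.
- move=> t; apply: cvgM; first exact: cvg_cst.
  apply: (@continuous_comp _ _ _ (fun b => b - p) (@rnorm R A)); last exact: rnorm_continuous.
  by apply: cvgB; [exact: cvg_id|exact: cvg_cst].
- move=> _ [h Ch <-]; rewrite mE// -(iotaZ HA _ Ch).
  apply: (iota_dist hmu HA); [exact: Cc_convolution|exact: CcZ| |].
    by rewrite mulr_ge0// rnorm_ge0.
  move=> pi Fpi x; set z := @completion_rep R G mu A iota pi p x.
  have zI g : pi g z = z.
    have [rp _] := Hp pi Fpi; have : range (@completion_rep R G mu A iota pi p) z by exists x.
    by rewrite rp.
  have hz := completion_rep_lipschitz hmu HF HA x p Fpi Ch.
  have -> : rint pi (fun g => intg f * h g) x = intg f *: rint pi h x.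
    apply: rep_integral_uniq => [//||xi]; first exact: CcZ.
    rewrite dualZ rep_integralP// -cintegralZ; last exact: coef_cintegrable.
    by congr (cintegral _ _); apply/funext => g; rewrite mulrA.
  rewrite rep_integral_convolution//.
  have -> : rint pi f (rint pi h x) - intg f *: rint pi h x =
      rint pi f (rint pi h x - z) - intg f *: (rint pi h x - z).
    rewrite (linB (rep_integral_linear hmu Cf)) (rep_integral_invariant hmu Cf zI).
    by rewrite scalerBr opprB addrA subrK.
  apply: le_trans (rnormD _ _) _; rewrite rnormN rnormZ -mulrA mulrDl.
  apply: lerD; last by apply: ler_wpM2l hz; exact: (@rnorm_ge0 _ R[i]^o (intg f)).
  apply: le_trans (rep_integral_iota1 hmu HF HA _ Cf Fpi) _.
  by rewrite ler_wpM2l ?rnorm_ge0.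
Qed.

(** Functions of integral 1 fix [q], hence so do their limits. With the version on the other side,
    one product of two elements is evaluated in two ways. *)
Lemma mean1_mull q q' : closure mean1 q' ->
  (forall f, Cc R G f -> m (iota f) q = intg f *: q) -> m q' q = q.
Proof.
move=> Sq' H; apply: (closure_eq (f := fun b => m b q) (g := fun=> q) _ _ _ Sq').
- by apply: completion_mul_continuous => t; [exact: cvg_id|exact: cvg_cst].
- by move=> t; exact: cvg_cst.
- by move=> _ [f [Cf f1] <-]; rewrite H// f1 scale1r.
Qed.

Lemma mean1_mulr q q' : closure mean1 q' ->
  (forall f, Cc R G f -> m q (iota f) = intg f *: q) -> m q q' = q.
Proof.
move=> Sq' H; apply: (closure_eq (f := fun b => m q b) (g := fun=> q) _ _ _ Sq').
- by apply: completion_mul_continuous => t; [exact: cvg_cst|exact: cvg_id].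
- by move=> t; exact: cvg_cst.
- by move=> _ [f [Cf f1] <-]; rewrite H// f1 scale1r.
Qed.

Lemma mean1_image p (u : (G -> R[i]) -> G -> R[i]) (T : A -> A) : continuous T ->
  (forall f, Cc R G f -> T (iota f) = iota (u f)) ->
  (forall f, Cc R G f -> intg f = 1 -> Cc R G (u f) /\ intg (u f) = 1) ->
  closure mean1 p -> closure mean1 (T p).
Proof.
move=> cT HT Hu Sp B /cT /Sp[_ [[f [Cf f1] <-] Bf]].
by exists (T (iota f)); split=> //; exists (u f); [exact: Hu|rewrite HT].
Qed.

(** In the constant [M * c], [M] bounds f~ in the class by [f] in the dual class, and [c] returns
    from the dual class to the class. *)
Lemma reflection_extends : weakly_self_adjoint mu F ->
  exists T : A -> A, extends iota (fun f => iota (refl f)) T.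
Proof.
move=> [c c0 Hc]; have [M M0 HM] := class_norm_reflection hmu HF.
have [|T lT HT] := @dense_extension R _ (Cc R G) A A iota (fun f => iota (refl f)) (M * c) iotaD.
  move=> f h Cf Ch; have Cfh := CcB Cf Ch.
  have [[Cf' _] [Ch' _]] := (reflectionP hmu Cf, reflectionP hmu Ch).
  rewrite -(iotaB HA Cf' Ch') -(iotaB HA Cf Ch).
  have -> : (fun x => refl f x - refl h x) = refl (fun x => f x - h x).
    have -> : (fun x => f x - h x) = (fun x => -1 * h x + f x).
      by apply/funext => x; rewrite mulN1r addrC.
    by rewrite reflection_linear//; apply/funext => x; rewrite mulN1r addrC.
  rewrite (rnorm_iota HA Cfh) (rnorm_iota HA (reflectionP hmu Cfh).1).
  apply: le_trans (HM _ Cfh) _; rewrite -mulrA ler_wpM2l//.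
  exact: (Hc _ Cfh).1.
by exists T; split=> //; exact: lipschitz_continuous lT.
Qed.

Lemma reflection_fixes p T : kazhdan_projection mu iota F p ->
  extends iota (fun f => iota (refl f)) T ->
  T p = p /\ forall f, Cc R G f -> m p (iota f) = intg f *: p.
Proof.
move=> Kp [cT HT]; have [_ Sp _] := Kp.
have Tabs f : Cc R G f -> m (T p) (iota f) = intg f *: T p.
  move=> Cf; have [Cf' _] := reflectionP hmu Cf.
  transitivity (T (m (iota (refl f)) p)).
    apply: (closure_eq (f := fun b => m (T b) (iota f)) (g := fun b => T (m (iota (refl f)) b))
      _ _ _ (@iotaD p)).
    - by apply: completion_mul_continuous => // t; exact: cvg_cst.
    - move=> t; apply: (@continuous_comp _ _ _ (fun b => m (iota (refl f)) b) T); last exact: cT.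
      exact: mul_continuousr.
    - move=> _ [h Ch <-]; have [Ch' _] := reflectionP hmu Ch.
      rewrite HT// !mE// HT; last exact: Cc_convolution.
      by rewrite reflection_convolution// reflectionK.
  rewrite kazhdan_projection_absorbs// cintegral_reflection//.
  (* [extends] provides continuity and values on Cc, so the homogeneity of [T] is obtained by
     density too. *)
  apply: (closure_eq (f := fun b => T (intg f *: b)) (g := fun b => intg f *: T b)
    _ _ _ (@iotaD p)).
  - move=> t; apply: (@continuous_comp _ _ _ (fun b => intg f *: b) T); last exact: cT.
    by apply: cvgZ; [exact: cvg_cst|exact: cvg_id].
  - by move=> t; apply: cvgZ; [exact: cvg_cst|exact: cT].
  - move=> _ [h Ch <-]; have [Ch' _] := reflectionP hmu Ch.
    rewrite -(iotaZ HA _ Ch) !HT// -?(iotaZ HA _ Ch')//; last exact: CcZ.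
    congr iota; have C0 := @Cc0 R G; have [C0' _] := reflectionP hmu C0.
    have z0 : refl (fun=> 0) = fun=> 0.
      have := reflection_linear hmu (-1) C0 C0.
      have -> : (fun _ : G => -1 * 0 + 0) = (fun=> 0) :> (G -> R[i]).
        by apply/funext => x; rewrite mulr0 addr0.
      by move=> ->; apply/funext => x; rewrite mulN1r addNr.
    have := reflection_linear hmu (intg f) Ch C0; rewrite z0.
    have E k : (fun x => intg f * k x + 0) = (fun x => intg f * k x) :> (G -> R[i]).
      by apply/funext => x; rewrite addr0.
    by rewrite !E.
have STp : closure mean1 (T p).
  apply: (mean1_image cT HT) Sp => f Cf f1.
  by rewrite cintegral_reflection//; split=> //; exact: (reflectionP hmu Cf).1.
have Tpp : T p = p.
  rewrite -[RHS](mean1_mull STp (fun f => kazhdan_projection_absorbs Kp)).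
  by rewrite (mean1_mulr Sp Tabs).
by split=> // f Cf; rewrite -Tpp Tabs.
Qed.

(** Conjugation is multiplicative, so [T p] absorbs when multiplied by functions on the left, as [p]
    does; the conjugate-linearity of [T] cancels the conjugate on the integral. The product of [p]
    and [T p] is [T p] by this absorption and [p] by the hypothesis on right multiplication. *)
Lemma conj_fixes p T : kazhdan_projection mu iota F p ->
  (forall f, Cc R G f -> m p (iota f) = intg f *: p) ->
  extends iota (fun f => iota (fun x => conjc (f x))) T -> T p = p.
Proof.
move=> Kp Habs [cT HT]; have [_ Sp _] := Kp.
have intgJ f : Cc R G f -> intg (fun x => conjc (f x)) = conjc (intg f).
  by move=> Cf; apply: cintegral_conj; exact: Cc_cintegrable.
have JK f : (fun x => conjc (conjc (f x))) = f by apply/funext => x; rewrite conjcK.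
have Tabs f : Cc R G f -> m (iota f) (T p) = intg f *: T p.
  move=> Cf; have Cf' := Cc_conj Cf.
  transitivity (T (m (iota (fun x => conjc (f x))) p)).
    apply: (closure_eq (f := fun b => m (iota f) (T b))
      (g := fun b => T (m (iota (fun x => conjc (f x))) b)) _ _ _ (@iotaD p)).
    - by apply: completion_mul_continuous => // t; exact: cvg_cst.
    - move=> t; apply: (@continuous_comp _ _ _
        (fun b => m (iota (fun x => conjc (f x))) b) T); last exact: cT.
      exact: mul_continuousr.
    - move=> _ [h Ch <-]; have Ch' := Cc_conj Ch.
      rewrite HT// !mE// HT; last exact: Cc_convolution.
      by congr iota; rewrite -convolution_conj// JK.
  rewrite kazhdan_projection_absorbs// intgJ//.
  apply: (closure_eq (f := fun b => T (conjc (intg f) *: b)) (g := fun b => intg f *: T b)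
    _ _ _ (@iotaD p)).
  - move=> t; apply: (@continuous_comp _ _ _ (fun b => conjc (intg f) *: b) T); last exact: cT.
    by apply: cvgZ; [exact: cvg_cst|exact: cvg_id].
  - by move=> t; apply: cvgZ; [exact: cvg_cst|exact: cT].
  - move=> _ [h Ch <-]; have Ch' := Cc_conj Ch.
    rewrite -(iotaZ HA _ Ch) !HT// -?(iotaZ HA _ Ch')//; last exact: CcZ.
    by congr iota; apply/funext => x; rewrite rmorphM /= conjcK.
have STp : closure mean1 (T p).
  apply: (mean1_image cT HT) Sp => f Cf f1.
  by rewrite intgJ// f1 rmorph1; split=> //; exact: Cc_conj.
by rewrite -[LHS](mean1_mull Sp Tabs) (mean1_mulr STp Habs).
Qed.

Lemma absorbing_central p : kazhdan_projection mu iota F p ->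
  (forall f, Cc R G f -> m p (iota f) = intg f *: p) -> central mu iota p.
Proof.
move=> Kp Habs a; apply: (closure_eq (f := fun b => m p b) (g := fun b => m b p)
  _ _ _ (@iotaD a)).
- by apply: completion_mul_continuous => t; [exact: cvg_cst|exact: cvg_id].
- by apply: completion_mul_continuous => t; [exact: cvg_id|exact: cvg_cst].
- by move=> _ [f Cf <-]; rewrite Habs// kazhdan_projection_absorbs.
Qed.

End kazhdan.

Theorem corollary3p5 (R : realType) (G : lcGroupType)
  (mu : {measure set (borel G) -> \bar R}) (F : rep_class R G)
  (A : completeNormedModType R[i]) (iota : (G -> R[i]) -> A) :
  compactly_generated G -> separable G -> infinite_set [set: G] ->
  left_haar mu ->
  bounded_on_compacts F ->
  is_completion mu F iota ->
  weakly_self_adjoint mu F ->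
  (forall p : A, kazhdan_projection mu iota F p ->
     central mu iota p /\ self_adjoint mu iota p) /\
  (conj_extends iota ->
   forall p : A, kazhdan_projection mu iota F p ->
     [/\ central mu iota p, self_adjoint mu iota p & real_element iota p]).
Proof.
move=> _ _ _ hmu HF HA wsa.
have [T HT] := reflection_extends hmu HF HA wsa.
have main p : kazhdan_projection mu iota F p ->
    central mu iota p /\ self_adjoint mu iota p.
  move=> Kp; have [Tp Habs] := reflection_fixes hmu HF HA Kp HT.
  by split; [exact: (absorbing_central hmu HF HA Kp Habs)|exists T].
split=> // -[C HC] p Kp; have [cp sp] := main p Kp; split=> //.
have [_ Habs] := reflection_fixes hmu HF HA Kp HT.
by exists C => //; exact: (conj_fixes hmu HF HA Kp Habs HC).
Qed.
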